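(* In the setting of the context, fix $x\in\mathcal X$ (write $\ell_k(z)=\ell_k(x,z)$), $i\in[N]$ and $\lambda\ge0$. Suppose the regularity assumption and the local worst-case oracle assumption hold. Then the algorithm BudgetEval described in the context, run with oracle precision $\epsilon>0$ and golden-section tolerance $\eta>0$, returns $\big(\hat b_i(\lambda),\hat V_i(\hat b_i(\lambda))\big)$ satisfying $$\max_{0\le b\le N\rho}\{V_i(b)-\lambda b\}-\Big(\hat V_i(\hat b_i(\lambda))-\lambda\hat b_i(\lambda)\Big)\le\begin{cases}O\big(\epsilon+\eta^{\min\{1/p,\,1-1/p\}}\big)&\text{if }p>1,\\ O\big(\epsilon+\eta^{1-r}\big)&\text{if }p=1,\end{cases}$$ with the running time complexity of $$\widetilde O\big(K^2\cdot\mathsf{Cost}_\epsilon\cdot\log^3(1/\eta)\big),$$ where $\mathsf{Cost}_{k,\epsilon}\le\mathsf{Cost}_\epsilon$ for all $k\in[K]$.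
   Context: Notation: $[n]=\{1,\dots,n\}$; $\mathcal P(\mathcal Z)$ is the set of Borel probability measures on $\mathcal Z$; $\phi=\frac{\sqrt5-1}2$. In the error bounds, the constants in $O(\cdot)$ depend on the remaining problem data but not on $\epsilon,\eta$; $\widetilde O$ suppresses logarithmic factors. Setting. $\mathcal X\subseteq\mathbb R^n$, $\mathcal Z\subseteq\mathbb R^m$. A transportation cost $c:\mathcal Z\times\mathcal Z\to\mathbb R_+$ is lower semicontinuous, satisfies $c(z,z)=0$ for all $z$, and $c(\cdot,\hat z)$ is convex for every fixed $\hat z\in\mathcal Z$. The optimal transport discrepancy is $\mathrm{OT}_c(\mathbb P,\mathbb Q)=\min_{\gamma}\mathbb E_{(z,\hat z)\sim\gamma}[c(z,\hat z)]$ over couplings $\gamma$ of $\mathbb P$ and $\mathbb Q$. Given $\hat z_1,\dots,\hat z_N\in\mathcal Z$, let $\hat{\mathbb P}=\frac1N\sum_{i=1}^N\delta_{\hat z_i}$; given $\rho>0$, let $\mathcal P=\{\mathbb P\in\mathcal P(\mathcal Z):\mathrm{OT}_c(\mathbb P,\hat{\mathbb P})\le\rho\}$. Regularity assumption. (i) $\mathcal X$ is nonempty and convex; there exist $\mathbb Q_0\in\mathcal P$ and $x_0\in\mathcal X$ such that $x\mapsto\mathbb E_{z\sim\mathbb Q_0}[\ell(x,z)]$ is inf-compact on $\mathcal X$ (all sublevel sets are compact) and $\mathbb E_{z\sim\mathbb Q_0}[\ell(x_0,z)]>-\infty$; $\mathcal Z$ is nonempty, closed and convex. (ii) $\ell(x,z)=\max_{k\in[K]}\ell_k(x,z)$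 with $K\ge2$, where each $\ell_k:\mathbb R^n\times\mathbb R^m\to\mathbb R$ is real-valued, convex in its first and concave in its second argument. (iii) There exist a norm $\|\cdot\|$ on $\mathbb R^m$ and $p\ge1$ with $c(z,\hat z)\ge\|z-\hat z\|^p$ for all $z,\hat z\in\mathcal Z$; moreover, if $p=1$, then for every $x\in\mathcal X$ there exist $g>0$, $\hat z_0\in\mathcal Z$ and $r\in[0,1)$ such that $\ell(x,z)\le g[1+\|z-\hat z_0\|^r]$. Local worst-case oracle assumption. For any $k\in[K]$, $\hat z\in\mathcal Z$, radius $u\ge0$ and accuracy $\epsilon>0$ there is an algorithm, denoted $(\hat L,\hat v)\gets\mathsf{WCO}_k^\epsilon(\hat z,u)$, running in time $\mathsf{Cost}_{k,\epsilon}$ that returns $\hat v\in\mathbb R^m$ with $\hat z+\hat v\in\mathcal Z$, $c(\hat z+\hat v,\hat z)\le u$, together with $\hat L=\ell_k(\hat z+\hat v)$ satisfying $\hat L\ge\max\{\ell_k(\hat z+v):v\in\mathbb R^m,\hat z+v\in\mathcal Z,c(\hat z+v,\hat z)\le u\}-\epsilon$. Local utilities. For $b\ge0$: $V_i(b)=\max_{1\le k_1<k_2\le K}V_i^{(k_1,k_2)}(b)$, where $V_i^{(k_1,k_2)}(b)$ is the maximum of $\alpha_1\ell_{k_1}(\hat z_i+v_1)+\alpha_2\ell_{k_2}(\hat z_i+v_2)$ over $\alpha_j,\beta_j\in\mathbb R_+$, $v_j\in\mathbb R^m$ with $\hat z_i+v_j\in\mathcal Z$, $\alpha_jc(\hat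 z_i+v_j,\hat z_i)\le\beta_j$ ($j=1,2$), $\alpha_1+\alpha_2=1$, $\beta_1+\beta_2=b$. Algorithms (all use the same $\eta,\epsilon$). InnerSolver$(i,k_1,k_2,b,\alpha_1)$ with $\alpha_1\in(0,1)$: set $\alpha_2=1-\alpha_1$, $L=0$, $U=b$, $\beta^{(1)}=U-\phi(U-L)$, $\beta^{(2)}=L+\phi(U-L)$. While $U-L>\eta$: for $j=1,2$ call $(L_1^{(j)},v_1^{(j)})\gets\mathsf{WCO}^\epsilon_{k_1}(\hat z_i,\beta^{(j)}/\alpha_1)$, $(L_2^{(j)},v_2^{(j)})\gets\mathsf{WCO}^\epsilon_{k_2}(\hat z_i,(b-\beta^{(j)})/\alpha_2)$ and set $V^{(j)}=\alpha_1L_1^{(j)}+\alpha_2L_2^{(j)}$; if $V^{(1)}<V^{(2)}$, set $L\gets\beta^{(1)}$, $\beta^{(1)}\gets\beta^{(2)}$, $\beta^{(2)}\gets L+\phi(U-L)$; otherwise set $U\gets\beta^{(2)}$, $\beta^{(2)}\gets\beta^{(1)}$, $\beta^{(1)}\gets U-\phi(U-L)$. Finally choose $j^\star\in\arg\max_jV^{(j)}$ and return the value $V^{(j^\star)}$ and the optimizer $(\alpha_1,\alpha_2,\beta^{(j^\star)},b-\beta^{(j^\star)},v_1^{(j^\star)},v_2^{(j^\star)})$, where $\beta^{(j^\star)}$ is the point at which $V^{(j^\star)}$ was evaluated. PairEval$(i,k_1,k_2,b)$: the same golden-section search over $\alpha\in[0,1]$ (start $L=0$, $U=1$, $\alpha^{(1)}=U-\phi(U-L)$,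 $\alpha^{(2)}=L+\phi(U-L)$, stop when $U-L\le\eta$, same interval updates), where the value $V^{(j)}$ and optimizer $s^{(j)}$ at $\alpha^{(j)}$ are those returned by InnerSolver$(i,k_1,k_2,b,\alpha^{(j)})$; return the larger of the two final values $V^{(j)}$ and its optimizer. LocalEval$(i,b)$: run PairEval$(i,k_1,k_2,b)$ for all $1\le k_1<k_2\le K$ and return the largest value, denoted $\hat V_i(b)$, its optimizer and the pair attaining it. BudgetEval$(i,\lambda)$: set $L=0$, $U=N\rho$, $b^{(1)}=U-\phi(U-L)$, $b^{(2)}=L+\phi(U-L)$, and let $\hat V^{(j)}$ be the value from LocalEval$(i,b^{(j)})$, $j=1,2$. While $U-L>\eta$: if $\hat V^{(1)}-\lambda b^{(1)}<\hat V^{(2)}-\lambda b^{(2)}$, set $L\gets b^{(1)}$, $b^{(1)}\gets b^{(2)}$ (carrying its value along), $b^{(2)}\gets L+\phi(U-L)$ and let $\hat V^{(2)}$ be the value from LocalEval$(i,b^{(2)})$; otherwise set $U\gets b^{(2)}$, $b^{(2)}\gets b^{(1)}$ (carrying its value along), $b^{(1)}\gets U-\phi(U-L)$ and let $\hat V^{(1)}$ be the value from LocalEval$(i,b^{(1)})$. Finally set $\hat b_i(\lambda)=L$ and return it together with the output of LocalEval$(i,\hat b_i(\lambda))$, in particular $\hat V_i(\hat b_i(\lambda))$. *)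

(* Defs.v *)
From HB Require Import structures.
From mathcomp Require Import all_boot all_order all_algebra.
From mathcomp Require Import all_classical all_reals all_analysis.

Set Implicit Arguments.
Unset Strict Implicit.
Unset Printing Implicit Defensive.

Import Order.TTheory GRing.Theory Num.Theory.
Import numFieldNormedType.Exports.

Local Open Scope classical_set_scope.
Local Open Scope ring_scope.

(** * The distributionally robust problem *)

(* Indices are 0-based: [i : 'I_N] and [k : 'I_K] stand for i.+1 and k.+1.
   [tcost] only matters on [pZ `*` pZ]; its values elsewhere are never used. *)
Record problem (R : realType) (n m K N : nat) := Problem {
  pX : set 'rV[R]_n ;
  pZ : set 'rV[R]_m ;
  tcost : 'rV[R]_m -> 'rV[R]_m -> R ;
  zhat : 'I_N -> 'rV[R]_m ;
  rho : R ;
  ell : 'I_K -> 'rV[R]_n -> 'rV[R]_m -> R }.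

(* R^m with its Borel sigma-algebra.  A Borel probability measure on a closed
   Z is represented by a probability measure on R^m giving mass 1 to Z. *)
Notation borel_rV R m :=
  (g_sigma_algebraType (@open 'rV[R]_m)).

Record is_norm (R : realType) (m : nat) (nrm : 'rV[R]_m -> R) : Prop := IsNorm {
  nrm_triangle : forall u v, nrm (u + v) <= nrm u + nrm v ;
  nrm_scale : forall (a : R) u, nrm (a *: u) = `|a| * nrm u ;
  nrm_eq0 : forall u, nrm u = 0 -> u = 0 }.

Section Problem.
Context (R : realType) (n m K N : nat) (pb : problem R n m K N).

(* [subspace A] carries the topology for which continuity properties of a
   function are those of its restriction to A. *)
Record transportation_cost : Prop := TransportationCost {
  tcost_ge0 : forall z zh, pZ pb z -> pZ pb zh -> 0 <= tcost pb z zh ;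
  tcost_lsc : lower_semicontinuous
    ((fun zz => (tcost pb zz.1 zz.2)%:E) : subspace (pZ pb `*` pZ pb) -> \bar R) ;
  tcost_diag : forall z, pZ pb z -> tcost pb z z = 0 ;
  tcost_convex : forall zh, pZ pb zh ->
    convex_function (pZ pb) (tcost pb ^~ zh) }.

Record setting : Prop := Setting {
  setting_cost : transportation_cost ;
  setting_zhat : forall i, pZ pb (zhat pb i) ;
  setting_rho : 0 < rho pb }.

(* The marginals are only constrained as set functions, so that the empirical
   measure below need not be packaged as a measure. *)
Definition is_coupling (P Q : set (borel_rV R m) -> \bar R)
    (gamma : probability (borel_rV R m * borel_rV R m)%type R) : Prop :=
  forall A : set (borel_rV R m), measurable A ->
    gamma (A `*` setT) = P A /\ gamma (setT `*` A) = Q A.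

Definition OT (P Q : set (borel_rV R m) -> \bar R) : \bar R :=
  ereal_inf
    [set (\int[gamma]_(zz in pZ pb `*` pZ pb) (tcost pb zz.1 zz.2)%:E)%E
      | gamma in is_coupling P Q].

Definition empirical (A : set (borel_rV R m)) : \bar R :=
  ((N%:R^-1)%:E * \sum_(i < N) \d_(zhat pb i : borel_rV R m) A)%E.

Definition ambiguity (P : probability (borel_rV R m) R) : Prop :=
  P (pZ pb) = 1%E /\ (OT P empirical <= (rho pb)%:E)%E.

(* Real-valued as soon as 0 < K. *)
Definition loss (x : 'rV[R]_n) (z : 'rV[R]_m) : \bar R :=
  \big[maxe/-oo%E]_(k < K) (ell pb k x z)%:E.

Definition expected_loss (P : probability (borel_rV R m) R) (x : 'rV[R]_n)
    : \bar R :=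
  (\int[P]_(z in pZ pb) loss x z)%E.

Definition inf_compact_on (X : set 'rV[R]_n) (f : 'rV[R]_n -> \bar R) : Prop :=
  forall t : R, compact [set x | X x /\ (f x <= t%:E)%E].

Definition growth_bound (nrm : 'rV[R]_m -> R) (x : 'rV[R]_n)
    (g : R) (zh0 : 'rV[R]_m) (r : R) : Prop :=
  [/\ 0 < g, pZ pb zh0, 0 <= r < 1 &
      forall z, pZ pb z -> (loss x z <= (g * (1 + nrm (z - zh0) `^ r))%:E)%E].

Record regularity (nrm : 'rV[R]_m -> R) (p : R) : Prop := Regularity {
  reg_X_neq0 : pX pb !=set0 ;
  reg_X_convex : convex_set (pX pb) ;
  reg_inf_compact : exists Q0 x0,
    [/\ ambiguity Q0, pX pb x0, inf_compact_on (pX pb) (expected_loss Q0) &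
        (-oo < expected_loss Q0 x0)%E] ;
  reg_Z_neq0 : pZ pb !=set0 ;
  reg_Z_closed : closed (pZ pb) ;
  reg_Z_convex : convex_set (pZ pb) ;
  reg_K : (2 <= K)%N ;
  reg_ell_convex : forall k z, convex_function setT (ell pb k ^~ z) ;
  reg_ell_concave : forall k x, convex_function setT (fun z => - ell pb k x z) ;
  reg_norm : is_norm nrm ;
  reg_p : 1 <= p ;
  reg_cost : forall z zh, pZ pb z -> pZ pb zh ->
    nrm (z - zh) `^ p <= tcost pb z zh ;
  reg_growth : p = 1 -> forall x, pX pb x ->
    exists g zh0 r, growth_bound nrm x g zh0 r }.

Record split_point := SplitPoint {
  alpha1 : R ; alpha2 : R ; beta1 : R ; beta2 : R ;
  disp1 : 'rV[R]_m ; disp2 : 'rV[R]_m }.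

Definition split_feasible (i : 'I_N) (b : R) (s : split_point) : Prop :=
  let z1 := zhat pb i + disp1 s in
  let z2 := zhat pb i + disp2 s in
  [/\ [/\ 0 <= alpha1 s, 0 <= alpha2 s, 0 <= beta1 s & 0 <= beta2 s],
      pZ pb z1 /\ pZ pb z2,
      alpha1 s * tcost pb z1 (zhat pb i) <= beta1 s /\
      alpha2 s * tcost pb z2 (zhat pb i) <= beta2 s &
      alpha1 s + alpha2 s = 1 /\ beta1 s + beta2 s = b].

(* Maxima over sets of real numbers are suprema in the extended reals. *)
Definition pair_utility (x : 'rV[R]_n) (i : 'I_N) (k1 k2 : 'I_K) (b : R)
    : \bar R :=
  ereal_sup
    [set (alpha1 s * ell pb k1 x (zhat pb i + disp1 s) +
          alpha2 s * ell pb k2 x (zhat pb i + disp2 s))%:E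
      | s in split_feasible i b].

Definition local_utility (x : 'rV[R]_n) (i : 'I_N) (b : R) : \bar R :=
  \big[maxe/-oo%E]_(kk : 'I_K * 'I_K | (kk.1 < kk.2)%N)
    pair_utility x i kk.1 kk.2 b.

Definition best_penalized_utility (x : 'rV[R]_n) (i : 'I_N) (lam : R)
    : \bar R :=
  ereal_sup [set (local_utility x i b - (lam * b)%:E)%E
    | b in [set b | 0 <= b <= N%:R * rho pb]].

End Problem.

(** * Timed, possibly diverging computations on real numbers *)

(* [Some (a, t)] returns [a] after time [t]; [None] does not return.  One unit
   of time stands for a bounded number of elementary operations (arithmetic and
   comparisons of reals, assignments). *)
Definition timed (R : realType) (A : Type) : Type := option (A * R).

Definition ret (R : realType) (A : Type) (a : A) : timed R A := Some (a, 0).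

Definition bind (R : realType) (A B : Type)
    (c : timed R A) (f : A -> timed R B) : timed R B :=
  if c is Some (a, t) then
    if f a is Some (b, u) then Some (b, t + u) else None
  else None.

Definition tick (R : realType) : timed R unit := Some (tt, 1).

Notation "'let*' x ':=' c 'in' d" := (bind c (fun x => d))
  (at level 200, x name, right associativity).

Section While.
Context (R : realType) (St : Type).
Context (guard : St -> bool) (body : St -> timed R St).

Fixpoint while_fuel (fuel : nat) (s : St) : timed R St :=
  if fuel is fuel'.+1 then
    let* _ := tick R in
    if guard s then let* s' := body s in while_fuel fuel' s' else ret R s
  else None.

(* The result does not depend on the fuel once there is enough of it. *)
Definition while (s : St) : timed R St :=
  if pselect (exists fuel, isSome (while_fuel fuel s)) is left e
  then while_fuel (ex_minn e) s else None.
End While.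

(** * Golden-section search *)

Definition phi (R : realType) : R := (Num.sqrt 5 - 1) / 2.

Definition lower_point (R : realType) (L U : R) : R := U - phi R * (U - L).
Definition upper_point (R : realType) (L U : R) : R := L + phi R * (U - L).

Section Golden.
Context (R : realType) (A : Type) (eta : R) (eval : R -> timed R (R * A)).

Record golden_state := GoldenState {
  gL : R ; gU : R ; g1 : R ; g2 : R ;
  gvals : option ((R * A) * (R * A)) }.

Definition golden_step (s : golden_state) : timed R golden_state :=
  let* e1 := eval (g1 s) in
  let* e2 := eval (g2 s) in
  ret R (if e1.1 < e2.1 then
           GoldenState (g1 s) (gU s) (g2 s) (upper_point (g1 s) (gU s))
             (Some (e1, e2))
         else
           GoldenState (gL s) (g2 s) (lower_point (gL s) (g2 s)) (g1 s)
             (Some (e1, e2))).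

(* If the initial interval is already shorter than [eta], the loop evaluates
   nothing and the two initial points are evaluated afterwards. *)
Definition golden (L0 U0 : R) : timed R (R * A) :=
  let* s := while (fun s => eta < gU s - gL s) golden_step
    (GoldenState L0 U0 (lower_point L0 U0) (upper_point L0 U0) None) in
  let* es :=
    (if gvals s is Some es then ret R es
     else let* e1 := eval (g1 s) in
          let* e2 := eval (g2 s) in
          ret R (e1, e2)) in
  let* _ := tick R in
  ret R (if es.1.1 < es.2.1 then es.2 else es.1).
End Golden.

(** * The oracle and the algorithms *)

(* [wco eps k zh u] is the run of the oracle for the k-th piece at accuracy
   [eps]; for fixed accuracy its output is a function of its inputs. *)
Definition oracle (R : realType) (m K : nat) : Type :=
  R -> 'I_K -> 'rV[R]_m -> R -> timed R (R * 'rV[R]_m).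

Section Algorithms.
Context (R : realType) (n m K N : nat) (pb : problem R n m K N).

(* Time is counted in units of at least one elementary step, so the bound
   [Cost k eps] on the time of a call is at least 1. *)
Definition wco_assumption (x : 'rV[R]_n) (wco : oracle R m K)
    (Cost : 'I_K -> R -> R) : Prop :=
  forall (eps : R) (k : 'I_K), 0 < eps ->
    1 <= Cost k eps /\
    forall (zh : 'rV[R]_m) (u : R), pZ pb zh -> 0 <= u ->
      let feasible := [set v | pZ pb (zh + v) /\ tcost pb (zh + v) zh <= u] in
      exists Lhat vhat t,
        [/\ wco eps k zh u = Some ((Lhat, vhat), t),
            0 <= t <= Cost k eps,
            feasible vhat,
            Lhat = ell pb k x (zh + vhat) &
            (ereal_sup [set (ell pb k x (zh + v))%:E | v in feasible] - eps%:E
              <= Lhat%:E)%E].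

Context (wco : oracle R m K) (eps eta : R).

Definition inner_solver (i : 'I_N) (k1 k2 : 'I_K) (b a1 : R)
    : timed R (R * split_point R m) :=
  let a2 := 1 - a1 in
  golden eta (fun beta =>
    let* r1 := wco eps k1 (zhat pb i) (beta / a1) in
    let* r2 := wco eps k2 (zhat pb i) ((b - beta) / a2) in
    let* _ := tick R in
    ret R (a1 * r1.1 + a2 * r2.1,
           SplitPoint a1 a2 beta (b - beta) r1.2 r2.2)) 0 b.

Definition pair_eval (i : 'I_N) (k1 k2 : 'I_K) (b : R)
    : timed R (R * split_point R m) :=
  golden eta (fun alpha => inner_solver i k1 k2 b alpha) 0 1.

(* Value, optimizer and pair of indices. *)
Definition local_output : Type := R * split_point R m * ('I_K * 'I_K).

Fixpoint best_pair (i : 'I_N) (b : R) (kk : 'I_K * 'I_K)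
    (kks : seq ('I_K * 'I_K)) {struct kks} : timed R local_output :=
  let* e := pair_eval i kk.1 kk.2 b in
  let* _ := tick R in
  if kks is kk' :: kks' then
    let* best := best_pair i b kk' kks' in
    ret R (if e.1 < best.1.1 then best else (e, kk))
  else ret R (e, kk).

Definition index_pairs : seq ('I_K * 'I_K) :=
  [seq kk : 'I_K * 'I_K <- enum {: 'I_K * 'I_K} | (kk.1 < kk.2)%N].

(* There is at least one pair when 2 <= K. *)
Definition local_eval (i : 'I_N) (b : R) : timed R local_output :=
  if index_pairs is kk :: kks then best_pair i b kk kks else None.

Record budget_state := BudgetState {
  bL : R ; bU : R ; b1 : R ; b2 : R ; bV1 : R ; bV2 : R }.

Definition budget_step (i : 'I_N) (lam : R) (s : budget_state)
    : timed R budget_state :=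
  if bV1 s - lam * b1 s < bV2 s - lam * b2 s then
    let b2' := upper_point (b1 s) (bU s) in
    let* o := local_eval i b2' in
    ret R (BudgetState (b1 s) (bU s) (b2 s) b2' (bV2 s) o.1.1)
  else
    let b1' := lower_point (bL s) (b2 s) in
    let* o := local_eval i b1' in
    ret R (BudgetState (bL s) (b2 s) b1' (b1 s) o.1.1 (bV1 s)).

Definition budget_eval (i : 'I_N) (lam : R) : timed R (R * local_output) :=
  let U0 := N%:R * rho pb in
  let b10 := lower_point 0 U0 in
  let b20 := upper_point 0 U0 in
  let* o1 := local_eval i b10 in
  let* o2 := local_eval i b20 in
  let* s := while (fun s => eta < bU s - bL s) (budget_step i lam)
    (BudgetState 0 U0 b10 b20 o1.1.1 o2.1.1) in
  let* o := local_eval i (bL s) in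
  ret R (bL s, o).

End Algorithms.

(* The O(eps + eta ^ q) guarantee with constant [C] for the budget and value
   returned by a terminating run. *)
Definition budget_error_le (R : realType) (n m K N : nat)
    (pb : problem R n m K N) (x : 'rV[R]_n) (wco : oracle R m K) (i : 'I_N)
    (lam C q eps eta : R) : Prop :=
  exists bhat (o : local_output R m K) t,
    budget_eval pb wco eps eta i lam = Some ((bhat, o), t) /\
    (best_penalized_utility pb x i lam - (o.1.1 - lam * bhat)%:E
      <= (C * (eps + eta `^ q))%:E)%E.

Definition budget_time_le (R : realType) (n m K N : nat)
    (pb : problem R n m K N) (wco : oracle R m K) (i : 'I_N)
    (lam eps eta T : R) : Prop :=
  exists out t, budget_eval pb wco eps eta i lam = Some (out, t) /\ t <= T.

(* Main.v *)
Require Import Defs.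
From mathcomp Require Import all_boot all_order all_algebra.
From mathcomp Require Import all_classical all_reals all_analysis.
From mathcomp Require Import ring lra.

Import Order.TTheory GRing.Theory Num.Theory.
Import numFieldNormedType.Exports.

Local Open Scope classical_set_scope.
Local Open Scope ring_scope.

(* Let h_k(u) be the supremum of the k-th piece over displacements of cost at
   most u.  Each h_k is concave and nondecreasing; since a finite concave
   function lies below an affine one, it grows at most like u^(1/p) above its
   value at 0 (and like u^r when p = 1).  Hence all three searches maximize
   concave functions that are Hölder continuous: beta |-> a h_1(beta/a) +
   (1-a) h_2((b-beta)/(1-a)) with exponent 1/p, its supremum over beta as a
   function of a with exponent 1-1/p (or 1-r), and the two-point concave hull
   of max_k h_k, which is V_i, with exponent 1/p.

   Errors do not accumulate along a golden-section search with evaluations in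
   [f - d, f].  If a step discards a point x, concavity gives f x <= v + 3d for
   the better current value v, and this value is kept until a better one is
   found.  If x is never discarded, it ends up within eta of the best point and
   the Hölder bound applies. *)

Set Implicit Arguments.
Unset Strict Implicit.
Unset Printing Implicit Defensive.

(** * Bounded iteration *)

Section WhileTheory.
Context (R : realType) (St : Type).
Context (guard : St -> bool) (body : St -> timed R St).

Lemma while_fuelS fuel s r :
  while_fuel guard body fuel s = Some r ->
  while_fuel guard body fuel.+1 s = Some r.
Proof.
elim: fuel s r => [//|fuel IH] s r.
change (while_fuel guard body fuel.+2 s) with
  (let* _ := tick R in
   if guard s then let* s' := body s in while_fuel guard body fuel.+1 s'
   else ret R s).
rewrite [while_fuel _ _ fuel.+1 s]/=.
case: (guard s) => //.
case: (body s) => [[s' t]|//] /=.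
case Hw: (while_fuel guard body fuel s') => [[s'' t'']|//].
by have /= := IH _ _ Hw => ->.
Qed.

Lemma whileE fuel s r :
  while_fuel guard body fuel s = Some r -> while guard body s = Some r.
Proof.
move=> Hr; rewrite /while.
case: pselect => [e|[]]; last by exists fuel; rewrite Hr.
case: ex_minnP => f0 f0P f0min.
have le0 : (f0 <= fuel)%N by apply: f0min; rewrite Hr.
case Hf : (while_fuel guard body f0 s) f0P => [r'|//] _.
rewrite -Hr -(subnK le0).
elim: (fuel - f0)%N => [|j IH]; first by rewrite add0n Hf.
by rewrite addSn (while_fuelS (esym IH)).
Qed.

Lemma while_spec (Inv : nat -> St -> Prop) (T : R) (J : nat) (s : St) :
  (forall s, Inv 0%N s -> ~~ guard s) ->
  (forall j s, Inv j.+1 s -> guard s ->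
     exists s' t, [/\ body s = Some (s', t), Inv j s' & t <= T]) ->
  0 <= T -> Inv J s ->
  exists s' t j, [/\ while guard body s = Some (s', t), Inv j s',
    ~~ guard s' & t <= J.+1%:R + J%:R * T].
Proof.
move=> Inv0 InvS T0 InvJ.
suff [s' [t [j [Hw Hi Hg Ht]]]] : exists s' t j,
  [/\ while_fuel guard body J.+1 s = Some (s', t), Inv j s',
    ~~ guard s' & t <= J.+1%:R + J%:R * T].
  by exists s', t, j; split => //; apply: whileE Hw.
elim: J s InvJ => [|J IH] s InvJ.
  exists s, (1 + 0), 0%N; rewrite /= (negbTE (Inv0 _ InvJ)).
  by split => //; lra.
case Hg : (guard s); last first.
  exists s, (1 + 0), J.+1; rewrite /= Hg; split => //.
  have : 0 <= J.+1%:R * T by rewrite mulr_ge0.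
  have : (1 : R) <= J.+2%:R by rewrite ler1n.
  lra.
have [s1 [t1 [Hb Hi1 Ht1]]] := InvS _ _ InvJ Hg.
have [s' [t [j [Hw Hi Hg' Ht]]]] := IH _ Hi1.
exists s', (1 + (t1 + t)), j; split => //.
  change (while_fuel guard body J.+2 s) with
    (let* _ := tick R in
     if guard s then let* s' := body s in while_fuel guard body J.+1 s'
     else ret R s).
  by rewrite Hg Hb /bind /tick Hw.
move: Ht; rewrite -[J.+2%:R]natr1 -[J.+1%:R]natr1; lra.
Qed.

End WhileTheory.

(** * Golden-section search on a noisy concave function *)

Definition concave_on (R : realType) (D : R -> Prop) (f : R -> R) :=
  forall x y t : R, D x -> D y -> 0 <= t <= 1 ->
    t * f x + (1 - t) * f y <= f (t * x + (1 - t) * y).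

Lemma concave_on_chord (R : realType) (D : R -> Prop) (f : R -> R) (x y z : R) :
  concave_on D f -> D x -> D z -> x <= y <= z ->
  (z - y) * f x + (y - x) * f z <= (z - x) * f y.
Proof.
move=> cf Dx Dz /andP[xy yz].
have [xz|xz] := ltP x z; last first.
  have ? : y = x by lra.
  have ? : z = x by lra.
  by subst; lra.
have zx0 : z - x != 0 by rewrite lt0r_neq0 // subr_gt0.
have t01 : 0 <= (z - y) / (z - x) <= 1.
  by rewrite divr_ge0 ?subr_ge0 ?(ltW xz) //= ler_pdivrMr ?subr_gt0 //; lra.
have := cf _ _ _ Dx Dz t01.
have -> : (z - y) / (z - x) * x + (1 - (z - y) / (z - x)) * z = y by field.
rewrite -(@ler_pM2l _ (z - x)) ?subr_gt0 //.
apply: le_trans; rewrite le_eqVlt; apply/orP; left; apply/eqP; field.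
exact: zx0.
Qed.

Lemma concave_on_increment (R : realType) (D : R -> Prop) (f : R -> R)
    (x y : R) :
  concave_on D f -> D 0 -> D y -> 0 <= x <= y -> f y - f x <= f (y - x) - f 0.
Proof.
move=> cf D0 Dy xy.
have [y0|y0] := ltP 0 y; last first.
  have -> : y = 0 by lra.
  have -> : x = 0 by lra.
  by rewrite !subr0.
have := concave_on_chord (y := x) cf D0 Dy xy.
have := concave_on_chord (y := y - x) cf D0 Dy.
have -> : 0 <= y - x <= y by lra.
move=> /(_ isT) h1 h2; rewrite -(ler_pM2l y0); lra.
Qed.

Section PhiTheory.
Context (R : realType).
Let phi := phi R.

Lemma phi_sqr : phi * phi = 1 - phi.
Proof.
have h := @sqr_sqrtr R 5 ltac:(lra).
by rewrite /phi /Defs.phi; nra.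
Qed.

Lemma phi_bounds : 3 / 5 <= phi <= 2 / 3.
Proof.
have h := @sqr_sqrtr R 5 ltac:(lra); have h0 := sqrtr_ge0 (5 : R).
by rewrite /phi /Defs.phi; nra.
Qed.

Lemma lower_upper_bounds (L U : R) : L <= U ->
  [/\ L <= lower_point L U, lower_point L U <= upper_point L U,
      upper_point L U <= U &
      L < U -> L < lower_point L U /\ upper_point L U < U].
Proof.
rewrite /lower_point /upper_point -/phi => LU; have := phi_bounds.
by split; nra.
Qed.

Lemma lower_point_shift (L U : R) :
  lower_point (lower_point L U) U = upper_point L U.
Proof.
rewrite /lower_point /upper_point -/phi.
have := phi_sqr; set w := U - L => h.
have -> : U - phi * (U - (U - phi * w)) = U - phi * phi * w by ring.
by rewrite h /w; ring.
Qed.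

Lemma upper_point_shift (L U : R) :
  upper_point L (upper_point L U) = lower_point L U.
Proof.
rewrite /lower_point /upper_point -/phi.
have := phi_sqr; set w := U - L => h.
have -> : L + phi * (L + phi * w - L) = L + phi * phi * w by ring.
by rewrite h /w; ring.
Qed.

Lemma width_lower (L U : R) : U - lower_point L U = phi * (U - L).
Proof. by rewrite /lower_point -/phi; ring. Qed.

Lemma width_upper (L U : R) : upper_point L U - L = phi * (U - L).
Proof. by rewrite /upper_point -/phi; ring. Qed.

Lemma golden_discard_left (D : R -> Prop) (f : R -> R) (L U x d v1 v2 : R) :
  concave_on D f -> D x -> D (upper_point L U) -> 0 <= d ->
  L <= x < lower_point L U ->
  f (lower_point L U) - d <= v1 -> v2 <= f (upper_point L U) -> v1 <= v2 ->
  f x <= v1 + 3 * d.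
Proof.
move=> cf Dx D2 d0 /andP[Lx xl] h1 h2 v12.
have b := phi_bounds.
have lu : lower_point L U <= upper_point L U.
  by move: Lx xl; rewrite /lower_point /upper_point -/phi; nra.
have := @concave_on_chord _ _ _ x (lower_point L U) _ cf Dx D2.
rewrite lu ltW // => /(_ isT).
have : lower_point L U - x <= 2 * (upper_point L U - lower_point L U).
  by move: Lx xl; rewrite /lower_point /upper_point -/phi; nra.
have : 0 < upper_point L U - lower_point L U.
  by move: Lx xl; rewrite /lower_point /upper_point -/phi; nra.
move: (lower_point L U) (upper_point L U) lu xl h1 h2 => a c.
move=> lu xa h1 h2 ac ax chord.
have : (a - x) * (f a - f c) <= (a - x) * d.
  by rewrite ler_wpM2l //; lra.
have : (a - x) * d <= 2 * (c - a) * d by rewrite ler_wpM2r.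
move=> h3 h4.
have : (c - a) * (f x - f a) <= (c - a) * (2 * d) by lra.
rewrite ler_pM2l //; lra.
Qed.

Lemma golden_discard_right (D : R -> Prop) (f : R -> R) (L U x d v1 v2 : R) :
  concave_on D f -> D x -> D (lower_point L U) -> 0 <= d ->
  upper_point L U < x <= U ->
  v1 <= f (lower_point L U) -> f (upper_point L U) - d <= v2 -> v2 <= v1 ->
  f x <= v2 + 3 * d.
Proof.
move=> cf Dx D1 d0 xU h1 h2 v12.
have reflL : lower_point (- U) (- L) = - upper_point L U :> R.
  by rewrite /lower_point /upper_point; ring.
have reflU : upper_point (- U) (- L) = - lower_point L U :> R.
  by rewrite /lower_point /upper_point; ring.
have cf' : concave_on (fun y => D (- y)) (fun y => f (- y)).
  move=> a b t Da Db t01 /=.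
  have -> : - (t * a + (1 - t) * b) = t * (- a) + (1 - t) * (- b) by ring.
  exact: cf.
have := @golden_discard_left _ _ (- U) (- L) (- x) d v2 v1 cf'.
rewrite reflL reflU !opprK; apply => //; lra.
Qed.

End PhiTheory.

Section GoldenSpec.
Context (R : realType) (A : Type) (eta E d C q : R).
Context (eval : R -> timed R (R * A)) (D : R -> Prop) (f : R -> R) (L0 U0 : R).
Hypotheses (eta0 : 0 < eta) (E0 : 0 <= E) (d0 : 0 <= d) (C0 : 0 <= C)
  (q0 : 0 <= q) (LU0 : L0 <= U0).
(* [D] is the closed or the open interval from [L0] to [U0]; the search never
   evaluates an end point of a nondegenerate interval. *)
Hypothesis D_interior :
  forall y, L0 <= y <= U0 -> (L0 < U0 -> L0 < y < U0) -> D y.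
Hypothesis D_sub : forall y, D y -> L0 <= y <= U0.
Hypothesis f_concave : concave_on D f.
Hypothesis f_holder :
  forall x y, D x -> D y -> f x - f y <= C * `|x - y| `^ q.
Hypothesis evalP : forall y, D y ->
  exists v a t, [/\ eval y = Some ((v, a), t), t <= E & f y - d <= v <= f y].
Context (J : nat) (HJ : phi R ^+ J * (U0 - L0) <= eta).

Let lower := @lower_point R.
Let upper := @upper_point R.

Lemma golden_points (L U : R) : L0 <= L -> L <= U -> U <= U0 ->
  (L0 < U0 -> L < U) -> D (lower L U) /\ D (upper L U).
Proof.
move=> h1 h2 h3 h4.
have [a b c e] := lower_upper_bounds h2.
by split; apply: D_interior; rewrite /lower /upper;
  [lra | move=> /h4 /e; lra | lra | move=> /h4 /e; lra].
Qed.

Lemma holder_close x y L U : D x -> D y -> L <= x <= U -> L <= y <= U ->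
  U - L <= eta -> f x - f y <= C * eta `^ q.
Proof.
move=> Dx Dy hx hy hLU; apply: le_trans (f_holder Dx Dy) _.
apply: ler_wpM2l => //; apply: ge0_ler_powR; rewrite ?nnegrE ?(ltW eta0) //.
by rewrite ler_norml; lra.
Qed.

Lemma golden_prune (L U x m v1 v2 : R) :
  D x -> D (lower L U) -> D (upper L U) ->
  f (lower L U) - d <= v1 <= f (lower L U) ->
  f (upper L U) - d <= v2 <= f (upper L U) ->
  L <= x <= U \/ f x <= m + 3 * d -> m <= Num.max v1 v2 ->
  (if v1 < v2 then lower L U <= x <= U else L <= x <= upper L U) \/
  f x <= Num.max v1 v2 + 3 * d.
Proof.
move=> Dx D1 D2 h1 h2 [hx|hx] hm; last by right; lra.
case: ifPn => v12.
  have [lx|lx] := leP (lower L U) x; first by left; lra.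
  right; have hl : L <= x < lower_point L U by rewrite -/lower; lra.
  have := golden_discard_left f_concave Dx D2 d0 hl (v1 := v1) (v2 := v2).
  rewrite -/lower -/upper => /(_ ltac:(lra) ltac:(lra) ltac:(lra)).
  have : v1 <= Num.max v1 v2 by rewrite le_max lexx.
  lra.
have [lx|lx] := leP x (upper L U); first by left; lra.
right; have hl : upper_point L U < x <= U by rewrite -/upper; lra.
have := golden_discard_right f_concave Dx D1 d0 hl (v1 := v1) (v2 := v2).
rewrite -/lower -/upper => /(_ ltac:(lra) ltac:(lra)).
have : v2 <= Num.max v1 v2 by rewrite le_max lexx orbT.
rewrite -leNgt in v12; lra.
Qed.

Let interval_inv (j : nat) (L U : R) :=
  [/\ L0 <= L, L <= U, U <= U0, L0 < U0 -> L < U & phi R ^+ j * (U - L) <= eta].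

(* The better of the last two values is the value at one of the two current
   points, so evaluating them again never loses it. *)
Let best_inv (L U g g' : R) (es : (R * A) * (R * A)) :=
  let m := Num.max es.1.1 es.2.1 in
  exists y, [/\ y = g \/ y = g', D y, L <= y <= U,
    (exists a t, eval y = Some ((m, a), t)) &
    m <= f y <= m + d /\
    forall x, D x -> L <= x <= U \/ f x <= m + 3 * d].

Let inv (j : nat) (s : golden_state R A) :=
  [/\ interval_inv j (gL s) (gU s),
      g1 s = lower (gL s) (gU s), g2 s = upper (gL s) (gU s) &
      if gvals s is Some es then best_inv (gL s) (gU s) (g1 s) (g2 s) es
      else gL s = L0 /\ gU s = U0].

Lemma interval_inv_step j L U : interval_inv j.+1 L U ->
  interval_inv j (lower L U) U /\ interval_inv j L (upper L U).
Proof.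
move=> [h1 h2 h3 h4 h5].
have [a b c e] := lower_upper_bounds h2.
rewrite /interval_inv /lower /upper width_lower width_upper.
rewrite ![phi R ^+ j * (phi R * (U - L))]mulrA -exprSr.
by split; split=> //; try lra; move=> /h4 /e; lra.
Qed.

Lemma golden_step_inv j s : inv j.+1 s ->
  exists s' t, [/\ golden_step eval s = Some (s', t), inv j s' & t <= 2 * E].
Proof.
case: s => L U a1 a2 vs; rewrite /inv /=; case=> hI -> -> hv.
have [iL iR] := interval_inv_step hI.
have [h1 h2 h3 h4 h5] := hI.
have [D1 D2] := golden_points h1 h2 h3 h4.
have [a b c _] := lower_upper_bounds h2.
have [v1 [e1 [t1 [E1 T1 B1]]]] := evalP D1.
have [v2 [e2 [t2 [E2 T2 B2]]]] := evalP D2.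
have prune x : D x -> (if v1 < v2 then lower L U <= x <= U
    else L <= x <= upper L U) \/ f x <= Num.max v1 v2 + 3 * d.
  move=> Dx; case: vs hv => [es|[eL eU]]; last first.
    apply: (golden_prune (m := Num.max v1 v2)) => //.
    by left; rewrite eL eU; exact: D_sub.
  move=> [y [yg Dy yLU [ay [ty Ey]] [mfy hx]]].
  apply: (golden_prune (m := Num.max es.1.1 es.2.1)) => //; first exact: hx.
  rewrite le_max; case: yg => yg; move: Ey; rewrite yg ?E1 ?E2 => -[-> _ _];
  by rewrite lexx ?orbT.
rewrite /golden_step /= E1 E2 /=.
exists (if v1 < v2 then
    GoldenState (lower L U) U (upper L U) (upper (lower L U) U)
      (Some ((v1, e1), (v2, e2)))
  else GoldenState L (upper L U) (lower L (upper L U)) (lower L U)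
      (Some ((v1, e1), (v2, e2)))), (t1 + (t2 + 0)); split => //; last lra.
case: ifPn prune => v12 prune /=; split => //=.
- by rewrite /lower /upper lower_point_shift.
- exists (upper L U).
  have mv : Num.max v1 v2 = v2 by apply/max_idPr/ltW.
  rewrite /= mv in prune *; split => //; first by left.
    by rewrite -/lower -/upper in a b c *; lra.
    by exists e2, t2.
  by split; [lra|].
- by rewrite /lower /upper upper_point_shift.
exists (lower L U).
have mv : Num.max v1 v2 = v1 by apply/max_idPl; rewrite leNgt.
rewrite /= mv in prune *; split => //; first by right.
  by rewrite -/lower -/upper in a b c *; lra.
  by exists e1, t1.
by split; [lra|].
Qed.

Theorem golden_spec : exists v a t,
  [/\ golden eta eval L0 U0 = Some ((v, a), t),
      t <= J.+2%:R * (2 * E + 2),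
      exists2 y, D y & v <= f y &
      forall x, D x -> f x <= v + 3 * d + C * eta `^ q].
Proof.
have invJ : inv J (GoldenState L0 U0 (lower L0 U0) (upper L0 U0) None).
  by split.
have guard0 s : inv 0 s -> ~~ (eta < gU s - gL s).
  by case=> -[_ _ _ _]; rewrite expr0 mul1r -leNgt.
have bodyP j s : inv j.+1 s -> eta < gU s - gL s -> exists s' t,
    [/\ golden_step eval s = Some (s', t), inv j s' & t <= 2 * E].
  by move=> hi _; exact: golden_step_inv.
have E20 : 0 <= 2 * E by rewrite mulr_ge0.
have [s [t [j [Hw Hi Hg Ht]]]] := while_spec guard0 bodyP E20 invJ.
rewrite /golden Hw /=.
case: s Hi Hg {Hw} => L U a1 a2 vs [] /=; rewrite -leNgt.
move=> [h1 h2 h3 h4 h5] -> -> hv hLU.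
have JE : 0 <= J%:R * (2 * E) by rewrite mulr_ge0.
have Jn : (0 : R) <= J%:R by [].
have -> : J.+2%:R * (2 * E + 2) = J%:R * (2 * E) + 2 * J%:R + 4 * E + 4 :> R.
  by rewrite -addn2 natrD; ring.
have Ht' : t <= 1 + J%:R + J%:R * (2 * E).
  by move: Ht; rewrite -add1n natrD.
case: vs hv => [[e1 e2]|[? ?]] /=.
  move=> [y [_ Dy yLU _ [mfy hx]]].
  exists (Num.max e1.1 e2.1), (if e1.1 < e2.1 then e2 else e1).2, (t + (0 + (1 + 0))).
  split; [|lra|by exists y => //; case/andP: mfy|].
    by rewrite /Num.max; case: ifP; [case: (e2)|case: (e1)].
  move=> x Dx; case: (hx _ Dx) => hx'.
    have := holder_close Dx Dy hx' yLU hLU; lra.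
  have : 0 <= C * eta `^ q by rewrite mulr_ge0 ?powR_ge0.
  lra.
subst L U.
have [D1 D2] := golden_points (lexx _) LU0 (lexx _) id.
have [v1 [e1 [t1 [-> T1 B1]]]] := evalP D1.
have [v2 [e2 [t2 [-> T2 B2]]]] := evalP D2.
rewrite /=.
exists (Num.max v1 v2), (if v1 < v2 then e2 else e1), (t + ((t1 + (t2 + 0)) + (1 + 0))).
split; [by rewrite /Num.max; case: ifP|lra| |].
  rewrite /Num.max; case: ifP => _.
    by exists (upper L0 U0) => //; lra.
  by exists (lower L0 U0) => //; lra.
move=> x Dx.
have := holder_close Dx D1 (D_sub Dx) (D_sub D1) hLU.
have : v1 <= Num.max v1 v2 by rewrite le_max lexx.
lra.
Qed.

End GoldenSpec.

(** * Concave nondecreasing utilities with sublinear growth *)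

Section PowR.
Context (R : realType).

Lemma powR_le_mul (x W s q : R) : 0 <= x <= W -> 1 <= W -> 0 < s ->
  q <= s <= 1 -> 0 <= q -> x `^ s <= W * x `^ q.
Proof.
move=> /andP[x0 xW] W1 s0 /andP[qs s1] q0.
have [->|xn0] := eqVneq x 0.
  by rewrite powR0 ?gt_eqF // mulr_ge0 ?powR_ge0; lra.
have -> : s = (s - q) + q by ring.
rewrite powRD; last by rewrite xn0 implybT.
rewrite ler_wpM2r ?powR_ge0 //.
have sq : 0 <= s - q by lra.
apply: (@le_trans _ _ (W `^ (s - q))).
  by apply: ge0_ler_powR; rewrite ?nnegrE //; lra.
by apply: ler1_powR => //; lra.
Qed.

Lemma powR_le1D (x r : R) : 0 <= x -> 0 <= r <= 1 -> x `^ r <= 1 + x.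
Proof.
move=> x0 /andP[r0 r1]; have [x1|x1] := leP x 1.
  have : x `^ r <= 1 `^ r by apply: ge0_ler_powR; rewrite ?nnegrE.
  by rewrite powR1; lra.
by have := ler1_powR (ltW x1) r1; lra.
Qed.

Lemma weight_powR (w u s : R) : 0 <= w <= 1 -> 0 <= u -> 0 < s <= 1 ->
  w * u `^ s <= (w * u) `^ s.
Proof.
move=> /andP[w0 w1] u0 /andP[s0 s1]; rewrite powRM // ler_wpM2r ?powR_ge0 //.
have [->|wn0] := eqVneq w 0; first by rewrite powR0 ?gt_eqF.
by apply: ger1_powR; rewrite // w1 andbT lt_neqAle eq_sym wn0.
Qed.

End PowR.

Definition nonneg_real (R : realType) (u : R) : Prop := 0 <= u.

Section Perspective.
Context (R : realType) (h : R -> R) (L M s r q W : R).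
Hypothesis h_concave : concave_on (@nonneg_real R) h.
Hypothesis h_mono : forall u v, 0 <= u <= v -> h u <= h v.
Hypothesis h_root : forall u, 0 <= u -> h u <= h 0 + L * u `^ s.
Hypothesis h_growth : forall u, 0 <= u -> h u <= M * (1 + u `^ r).
Hypotheses (L0 : 0 <= L) (M0 : 0 <= M) (s01 : 0 < s <= 1) (r01 : 0 <= r < 1)
  (q0 : 0 <= q) (qs : q <= s) (qr : q <= 1 - r) (W1 : 1 <= W).

Lemma persp_concave (a a' u u' t : R) : 0 < a -> 0 < a' -> 0 <= u -> 0 <= u' ->
  0 <= t <= 1 ->
  t * (a * h (u / a)) + (1 - t) * (a' * h (u' / a')) <=
  (t * a + (1 - t) * a') * h ((t * u + (1 - t) * u') / (t * a + (1 - t) * a')).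
Proof.
move=> a0 a'0 u0 u'0 t01; set c := t * a + (1 - t) * a'.
have c0 : 0 < c by rewrite /c; nra.
have cn0 : c != 0 by rewrite gt_eqF.
have tc : 0 <= t * a / c <= 1.
  rewrite divr_ge0 ?(ltW c0) ?mulr_ge0 //=; [|lra|lra].
  by rewrite ler_pdivrMr // /c; nra.
have E1 : 1 - t * a / c = (1 - t) * a' / c.
  by apply: (mulIf cn0); rewrite mulrBl !divfK // mul1r /c; ring.
have := h_concave (divr_ge0 u0 (ltW a0)) (divr_ge0 u'0 (ltW a'0)) tc.
rewrite E1.
have -> : t * a / c * (u / a) + (1 - t) * a' / c * (u' / a') =
    (t * u + (1 - t) * u') / c by field; rewrite cn0 !gt_eqF.
rewrite -(ler_pM2l c0); apply: le_trans.
by rewrite le_eqVlt; apply/orP; left; apply/eqP; field.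
Qed.

Lemma h_increment (x y : R) : 0 <= x <= y -> h y - h x <= L * (y - x) `^ s.
Proof.
move=> xy; have := concave_on_increment h_concave (y := y) (lexx _) _ xy.
have := h_root (u := y - x); rewrite /nonneg_real; lra.
Qed.

Lemma persp_increment (a x y : R) : 0 < a <= 1 -> 0 <= x <= y ->
  a * h (y / a) - a * h (x / a) <= L * (y - x) `^ s.
Proof.
move=> /andP[a0 a1] /andP[x0 xy].
have xya : 0 <= x / a <= y / a.
  by rewrite divr_ge0 ?(ltW a0) //= ler_pM2r // invr_gt0.
have := h_increment xya; rewrite -(ler_pM2l a0) -mulrBl mulrBr => /le_trans; apply.
rewrite mulrCA ler_wpM2l //.
have -> : y - x = a * ((y - x) / a) by field; rewrite gt_eqF.
rewrite [X in _ * (X / a) `^ _](_ : _ = y - x); last by field; rewrite gt_eqF.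
by apply: weight_powR => //; rewrite ?divr_ge0 ?subr_ge0 //; lra.
Qed.

Lemma persp_mono (a x y : R) : 0 < a -> 0 <= x <= y ->
  a * h (x / a) <= a * h (y / a).
Proof.
move=> a0 /andP[x0 xy]; rewrite ler_pM2l //; apply: h_mono.
by rewrite divr_ge0 ?(ltW a0) //= ler_pM2r // invr_gt0.
Qed.

Lemma persp_weight_grow (a a' u : R) : 0 < a <= a' -> 0 <= u ->
  a * h (u / a) - a' * h (u / a') <= (a' - a) * `|h 0|.
Proof.
move=> /andP[a0 aa'] u0.
have a'0 : 0 < a' by lra.
have t01 : 0 <= a / a' <= 1.
  by rewrite divr_ge0 ?(ltW a0) ?(ltW a'0) //= ler_pdivrMr // mul1r.
have := h_concave (x := u / a) (y := 0) (divr_ge0 u0 (ltW a0)) (lexx _) t01.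
have -> : a / a' * (u / a) + (1 - a / a') * 0 = u / a'.
  by field; rewrite !gt_eqF.
rewrite -(ler_pM2l a'0) mulrDr.
have -> : a' * (a / a' * h (u / a)) = a * h (u / a) by field; rewrite gt_eqF.
have -> : a' * ((1 - a / a') * h 0) = (a' - a) * h 0 by field; rewrite gt_eqF.
have := ler_norm (- h 0); rewrite normrN.
move: (u / a) (u / a') => X Y; nra.
Qed.

Lemma persp_weight_shrink (a a' u : R) : 0 < a' <= a -> a <= 1 -> 0 <= u <= W ->
  a * h (u / a) - a' * h (u / a') <= M * (2 + W) * (a - a') `^ q.
Proof.
move=> /andP[a'0 aa'] a1 /andP[u0 uW].
have r01' := r01; have W1' := W1; have M0' := M0.
have a0 : 0 < a by lra.
have ua : 0 <= u / a by rewrite divr_ge0 // ltW.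
have h1 : h (u / a) <= h (u / a').
  by apply: h_mono; rewrite ua /= ler_wpM2l // lef_pV2.
have h2 := h_growth ua.
have [ea|na] := eqVneq a a'.
  by rewrite ea subrr mulr_ge0 ?powR_ge0 // mulr_ge0 //; lra.
have d0 : 0 < a - a' by rewrite subr_gt0 lt_neqAle eq_sym na.
have [d dE] : exists d : R, d = a - a' by exists (a - a').
rewrite -dE in d0 *.
have q1 : q <= 1 by move: qr; lra.
have d01 : 0 < d <= 1 by rewrite d0 /= dE; lra.
have dq : d <= d `^ q by exact: ger1_powR.
have dr : d `^ (1 - r) <= d `^ q by exact: ger_powR.
have key : d * (u / a) `^ r <= (1 + W) * d `^ (1 - r).
  apply: (@le_trans _ _ (d * (u / d) `^ r)).
    rewrite ler_pM2l //; apply: ge0_ler_powR; rewrite ?nnegrE //; first lra.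
      by rewrite divr_ge0 // ltW.
    by rewrite ler_wpM2l // lef_pV2 //; lra.
  rewrite powRM ?invr_ge0 ?(ltW d0) // -(powR_inv1 (ltW d0)) -powRrM mulN1r.
  have -> : d * (u `^ r * d `^ (- r)) = u `^ r * d `^ (1 - r).
    rewrite mulrCA powRD ?powRr1 ?(ltW d0) //.
    by rewrite (gt_eqF d0) implybT.
  rewrite ler_wpM2r ?powR_ge0 //; apply: le_trans (powR_le1D u0 _) _; lra.
have : d * h (u / a) <= d * (M * (1 + (u / a) `^ r)) by rewrite ler_pM2l.
have : a' * h (u / a) <= a' * h (u / a') by rewrite ler_pM2l.
have : M * (d + d * (u / a) `^ r) <= M * (d `^ q + (1 + W) * d `^ q).
  apply: ler_wpM2l => //; apply: lerD => //; apply: (le_trans key).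
  by rewrite ler_wpM2l //; lra.
have -> : a = d + a' by lra.
lra.
Qed.

Lemma persp_weight_holder (a a' u H0 : R) : 0 < a < 1 -> 0 < a' < 1 ->
  0 <= u <= W -> `|h 0| <= H0 ->
  a * h (u / a) - a' * h (u / a') <=
  (H0 + M * (2 + W)) * `|a - a'| `^ q.
Proof.
move=> ha ha' uW hH.
have r01' := r01; have W1' := W1; have M0' := M0; have qr' := qr.
have C0 : 0 <= M * (2 + W) by rewrite mulr_ge0 //; lra.
have H00 : 0 <= H0 by apply: le_trans hH.
have [aa'|aa'] := leP a a'.
  rewrite ler0_norm; last lra.
  have := @persp_weight_grow a a' u ltac:(lra) ltac:(lra).
  have [->|na] := eqVneq a a'; first by
    move=> _; rewrite !subrr mulr_ge0 ?powR_ge0 //; lra.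
  have d0 : 0 < a' - a by rewrite subr_gt0 lt_neqAle na.
  have dq : a' - a <= (a' - a) `^ q by apply: ger1_powR; lra.
  have := powR_ge0 (a' - a) q.
  rewrite opprB; set D := (_ `^ q) in dq * => D0 h1.
  have h2 : (a' - a) * `|h 0| <= D * H0 by apply: ler_pM => //; lra.
  have : 0 <= M * (2 + W) * D by rewrite mulr_ge0.
  lra.
rewrite gtr0_norm; last lra.
have := @persp_weight_shrink a a' u ltac:(lra) ltac:(lra) uW.
have : 0 <= H0 * (a - a') `^ q by rewrite mulr_ge0 ?powR_ge0.
lra.
Qed.

End Perspective.

Record utility (R : realType) (h : R -> R) (L M s r : R) : Prop := Utility {
  util_concave : concave_on (@nonneg_real R) h ;
  util_mono : forall u v, 0 <= u <= v -> h u <= h v ;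
  util_root : forall u, 0 <= u -> h u <= h 0 + L * u `^ s ;
  util_growth : forall u, 0 <= u -> h u <= M * (1 + u `^ r) }.

Record exponents (R : realType) (L M s r q W : R) : Prop := Exponents {
  exp_L : 0 <= L ; exp_M : 0 <= M ; exp_s : 0 < s <= 1 ; exp_r : 0 <= r < 1 ;
  exp_q0 : 0 <= q ; exp_qs : q <= s ; exp_qr : q <= 1 - r ; exp_W : 1 <= W }.

Lemma mean_ge (R : realType) (lo x y t : R) : 0 <= t <= 1 ->
  lo <= x -> lo <= y -> lo <= t * x + (1 - t) * y.
Proof.
move=> ht hx hy.
have : 0 <= t * (x - lo) by rewrite mulr_ge0 //; lra.
have : 0 <= (1 - t) * (y - lo) by rewrite mulr_ge0 //; lra.
lra.
Qed.

Lemma mean_gt (R : realType) (lo x y t : R) : 0 <= t <= 1 ->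
  lo < x -> lo < y -> lo < t * x + (1 - t) * y.
Proof.
move=> ht hx hy; apply: (@lt_le_trans _ _ (Num.min x y)).
  by rewrite lt_min hx hy.
by apply: mean_ge => //; rewrite ge_min lexx ?orbT.
Qed.

Lemma mean_le (R : realType) (hi x y t : R) : 0 <= t <= 1 ->
  x <= hi -> y <= hi -> t * x + (1 - t) * y <= hi.
Proof.
move=> ht hx hy; have := @mean_ge _ (- hi) (- x) (- y) t ht; lra.
Qed.

Lemma mean_lt (R : realType) (hi x y t : R) : 0 <= t <= 1 ->
  x < hi -> y < hi -> t * x + (1 - t) * y < hi.
Proof.
move=> ht hx hy; have := @mean_gt _ (- hi) (- x) (- y) t ht; lra.
Qed.

(** * Splitting a budget between two utilities *)

Section Split.
Context (R : realType) (h1 h2 : R -> R) (L M s r q W b : R).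
Hypotheses (U1 : utility h1 L M s r) (U2 : utility h2 L M s r)
  (ex : exponents L M s r q W) (b0W : 0 <= b <= W).

Definition split_value (al be : R) :=
  al * h1 (be / al) + (1 - al) * h2 ((b - be) / (1 - al)).

Definition split_sup (al : R) :=
  sup [set split_value al be | be in [set be | 0 <= be <= b]].

Definition open_unit (al : R) : Prop := 0 < al < 1.

Lemma split_value_concave al al' be be' t : open_unit al -> open_unit al' ->
  0 <= be <= b -> 0 <= be' <= b -> 0 <= t <= 1 ->
  t * split_value al be + (1 - t) * split_value al' be' <=
  split_value (t * al + (1 - t) * al') (t * be + (1 - t) * be').
Proof.
rewrite /open_unit => ha ha' hbe hbe' ht; rewrite /split_value.
have := @persp_concave _ _ (util_concave U1) al al' be be' t
  ltac:(lra) ltac:(lra) ltac:(lra) ltac:(lra) ht.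
have := @persp_concave _ _ (util_concave U2) (1 - al) (1 - al')
  (b - be) (b - be') t ltac:(lra) ltac:(lra) ltac:(lra) ltac:(lra) ht.
have -> : t * (1 - al) + (1 - t) * (1 - al') = 1 - (t * al + (1 - t) * al').
  by ring.
have -> : t * (b - be) + (1 - t) * (b - be') = b - (t * be + (1 - t) * be').
  by ring.
lra.
Qed.

Lemma split_value_concave_budget al : open_unit al ->
  concave_on (fun be => 0 <= be <= b) (split_value al).
Proof.
move=> ha be be' t hbe hbe' ht.
have := split_value_concave ha ha hbe hbe' ht.
by have -> : t * al + (1 - t) * al = al by ring.
Qed.

Lemma split_value_holder_budget al be be' : open_unit al ->
  0 <= be <= b -> 0 <= be' <= b ->
  split_value al be - split_value al be' <= L * W * `|be - be'| `^ q.
Proof.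
rewrite /open_unit => ha hbe hbe'; rewrite /split_value.
have bW := b0W.
have [L0 M0 s01 r01 q0 qs qr W1] := ex.
have pw d : 0 <= d <= b -> L * d `^ s <= L * W * d `^ q.
  move=> hd; rewrite -mulrA; apply: ler_wpM2l => //.
  by apply: powR_le_mul => //; lra.
have [le|le] := leP be be'.
  rewrite ler0_norm; last lra.
  have h1m := @persp_mono _ _ (util_mono U1) al be be' ltac:(lra) ltac:(lra).
  have := @persp_increment _ _ _ _ (util_concave U2) (util_root U2) L0 s01
    (1 - al) (b - be') (b - be) ltac:(lra) ltac:(lra).
  have -> : b - be - (b - be') = - (be - be') by ring.
  have := pw (- (be - be')) ltac:(lra).
  lra.
rewrite gtr0_norm; last lra.
have h2m := @persp_mono _ _ (util_mono U2) (1 - al) (b - be) (b - be')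
  ltac:(lra) ltac:(lra).
have := @persp_increment _ _ _ _ (util_concave U1) (util_root U1) L0 s01
  al be' be ltac:(lra) ltac:(lra).
have := pw (be - be') ltac:(lra).
lra.
Qed.

Lemma split_value_holder_weight (H0 al al' be : R) : open_unit al -> open_unit al' ->
  0 <= be <= b -> `|h1 0| <= H0 -> `|h2 0| <= H0 ->
  split_value al be - split_value al' be <=
  2 * (H0 + M * (2 + W)) * `|al - al'| `^ q.
Proof.
rewrite /open_unit => ha ha' hbe H1 H2; rewrite /split_value.
have bW := b0W.
have [L0 M0 s01 r01 q0 qs qr W1] := ex.
have := @persp_weight_holder _ _ M r q W (util_concave U1) (util_mono U1)
  (util_growth U1) M0 r01 qr W1 al al' be H0 ha ha' ltac:(lra) H1.
have := @persp_weight_holder _ _ M r q W (util_concave U2) (util_mono U2)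
  (util_growth U2) M0 r01 qr W1 (1 - al) (1 - al') (b - be) H0
  ltac:(lra) ltac:(lra) ltac:(lra) H2.
have -> : 1 - al - (1 - al') = - (al - al') by ring.
rewrite normrN; lra.
Qed.

Lemma split_value_bounded al : open_unit al ->
  has_sup [set split_value al be | be in [set be | 0 <= be <= b]].
Proof.
rewrite /open_unit => ha; have bW := b0W; split.
  by exists (split_value al 0), 0 => //=; lra.
exists (al * h1 (b / al) + (1 - al) * h2 (b / (1 - al))) => _ [be /= hbe <-].
apply: lerD; first by apply: (persp_mono (util_mono U1)); lra.
by apply: (persp_mono (util_mono U2)); lra.
Qed.

Lemma split_sup_ge al be : open_unit al -> 0 <= be <= b ->
  split_value al be <= split_sup al.
Proof.
move=> ha hbe; apply: sup_upper_bound; first exact: split_value_bounded.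
by exists be.
Qed.

Lemma split_sup_le al y : open_unit al ->
  (forall be, 0 <= be <= b -> split_value al be <= y) -> split_sup al <= y.
Proof.
move=> ha hy; apply: ge_sup; first by have [] := split_value_bounded ha.
by move=> _ [be /= hbe <-]; exact: hy.
Qed.

Lemma split_sup_adherent al e : open_unit al -> 0 < e ->
  exists2 be, 0 <= be <= b & split_sup al - e < split_value al be.
Proof.
move=> ha e0.
have [_ [be /= hbe <-] h] := sup_adherent e0 (split_value_bounded ha).
by exists be.
Qed.

Lemma split_sup_concave : concave_on open_unit split_sup.
Proof.
move=> al al' t ha ha' ht.
have hc : open_unit (t * al + (1 - t) * al').
  move: ha ha' => /andP[? ?] /andP[? ?].
  by apply/andP; split; [exact: mean_gt|exact: mean_lt].
apply/ler_addgt0Pr => e e0.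
have [be hbe H] := split_sup_adherent ha e0.
have [be' hbe' H'] := split_sup_adherent ha' e0.
have := split_value_concave ha ha' hbe hbe' ht.
have := split_sup_ge hc (be := t * be + (1 - t) * be').
have -> : 0 <= t * be + (1 - t) * be' <= b.
  move: hbe hbe' => /andP[? ?] /andP[? ?].
  by apply/andP; split; [exact: mean_ge|exact: mean_le].
move=> /(_ isT).
have : t * (split_sup al - e) <= t * split_value al be.
  by apply: ler_wpM2l; lra.
have : (1 - t) * (split_sup al' - e) <= (1 - t) * split_value al' be'.
  by apply: ler_wpM2l; lra.
lra.
Qed.

Lemma split_sup_holder H0 al al' : open_unit al -> open_unit al' ->
  `|h1 0| <= H0 -> `|h2 0| <= H0 ->
  split_sup al - split_sup al' <=
  2 * (H0 + M * (2 + W)) * `|al - al'| `^ q.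
Proof.
move=> ha ha' H1 H2; rewrite lerBlDr; apply: split_sup_le => // be hbe.
have := split_value_holder_weight ha ha' hbe H1 H2.
have := split_sup_ge ha' hbe; lra.
Qed.

End Split.

(** * Concave hulls by two atoms *)

Section TwoAtoms.
Context (R : realType).
Implicit Types E : R -> R -> Prop.

Definition two_atoms E (b y : R) : Prop :=
  exists w u1 y1 u2 y2, [/\ 0 <= w <= 1, E u1 y1, E u2 y2,
    b = w * u1 + (1 - w) * u2 & y <= w * y1 + (1 - w) * y2].

Lemma two_atoms_le E b y y' : y' <= y -> two_atoms E b y -> two_atoms E b y'.
Proof.
move=> le [w [u1 [y1 [u2 [y2 [? ? ? ? ?]]]]]].
by exists w, u1, y1, u2, y2; split => //; lra.
Qed.

(* The mean splits into a mixture of points above it on the segments joining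
   the first atom to the two others. *)
Lemma three_atoms_side E u1 y1 u2 y2 u3 y3 w1 w2 w3 b :
  E u1 y1 -> E u2 y2 -> E u3 y3 -> 0 <= w1 -> 0 <= w2 -> 0 <= w3 ->
  w1 + w2 + w3 = 1 -> b = w1 * u1 + w2 * u2 + w3 * u3 ->
  u1 <= b -> b <= u2 -> b <= u3 ->
  two_atoms E b (w1 * y1 + w2 * y2 + w3 * y3).
Proof.
move=> E1 E2 E3 p1 p2 p3 ws bE b1 b2 b3.
have [w20|w2n] := eqVneq w2 0.
  exists w1, u1, y1, u3, y3; have w3E : 1 - w1 = w3 by lra.
  by rewrite w3E bE w20; split => //; lra.
have [w30|w3n] := eqVneq w3 0.
  exists w1, u1, y1, u2, y2; have w3E : 1 - w1 = w2 by lra.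
  by rewrite w3E bE w30; split => //; lra.
have w2p : 0 < w2 by rewrite lt_neqAle eq_sym w2n.
have w3p : 0 < w3 by rewrite lt_neqAle eq_sym w3n.
have w1E : w1 = 1 - w2 - w3 by lra.
have bal : w2 * (u2 - u1) + w3 * (u3 - u1) = b - u1.
  by rewrite bE w1E; ring.
have [B0|Bn] := eqVneq (b - u1) 0.
  have D2 : 0 <= w2 * (u2 - u1) by rewrite mulr_ge0 //; lra.
  have D3 : 0 <= w3 * (u3 - u1) by rewrite mulr_ge0 //; lra.
  have /eqP : w2 * (u2 - u1) = 0 by lra.
  rewrite mulf_eq0 (negbTE w2n) /= => /eqP e2.
  have /eqP : w3 * (u3 - u1) = 0 by lra.
  rewrite mulf_eq0 (negbTE w3n) /= => /eqP e3.
  have pick u y : E u y -> u = b -> y1 <= y -> y2 <= y -> y3 <= y ->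
      two_atoms E b (w1 * y1 + w2 * y2 + w3 * y3).
    move=> Eu ub l1 l2 l3; exists 1, u, y, u, y; split => //; try lra.
    have : w1 * y1 <= w1 * y by exact: ler_wpM2l.
    have : w2 * y2 <= w2 * y by exact: ler_wpM2l.
    have : w3 * y3 <= w3 * y by exact: ler_wpM2l.
    have : (w1 + w2 + w3) * y = y by rewrite ws mul1r.
    lra.
  have [l12|l12] := leP y1 y2.
    have [l23|l23] := leP y2 y3.
      by apply: (pick _ _ E3); lra.
    by apply: (pick _ _ E2); lra.
  have [l13|l13] := leP y1 y3.
    by apply: (pick _ _ E3); lra.
  by apply: (pick _ _ E1); lra.
have Bp : 0 < b - u1 by rewrite lt_neqAle eq_sym Bn; lra.
have D2 : 0 < u2 - u1 by lra.
have D3 : 0 < u3 - u1 by lra.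
set T := w2 * (y2 - y1) + w3 * (y3 - y1).
have valE : w1 * y1 + w2 * y2 + w3 * y3 = y1 + T.
  by rewrite /T w1E; ring.
have segment u y : E u y -> 0 < u - u1 -> b <= u ->
    T * (u - u1) <= (b - u1) * (y - y1) -> two_atoms E b (y1 + T).
  move=> Eu up bu le; exists ((u - b) / (u - u1)), u1, y1, u, y.
  have -> : 1 - (u - b) / (u - u1) = (b - u1) / (u - u1).
    by field; rewrite gt_eqF.
  split => //.
  - rewrite divr_ge0 ?(ltW up) //=; last lra.
    by rewrite ler_pdivrMr //; lra.
  - by field; rewrite gt_eqF.
  - have -> : (u - b) / (u - u1) * y1 + (b - u1) / (u - u1) * y =
        y1 + (b - u1) * (y - y1) / (u - u1) by field; rewrite gt_eqF.
    by rewrite lerD2l ler_pdivlMr.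
rewrite valE.
have [le2|gt2] := leP (T * (u2 - u1)) ((b - u1) * (y2 - y1)).
  exact: (segment _ _ E2).
have [le3|gt3] := leP (T * (u3 - u1)) ((b - u1) * (y3 - y1)).
  exact: (segment _ _ E3).
exfalso.
have g2 : w2 * ((b - u1) * (y2 - y1)) < w2 * (T * (u2 - u1)) by rewrite ltr_pM2l.
have g3 : w3 * ((b - u1) * (y3 - y1)) < w3 * (T * (u3 - u1)) by rewrite ltr_pM2l.
have : T * (w2 * (u2 - u1) + w3 * (u3 - u1)) = T * (b - u1) by rewrite bal.
have : (b - u1) * T = (b - u1) * (w2 * (y2 - y1) + w3 * (y3 - y1)) by [].
clearbody T; lra.
Qed.

Lemma three_atoms_side_opp E u1 y1 u2 y2 u3 y3 w1 w2 w3 b :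
  E u1 y1 -> E u2 y2 -> E u3 y3 -> 0 <= w1 -> 0 <= w2 -> 0 <= w3 ->
  w1 + w2 + w3 = 1 -> b = w1 * u1 + w2 * u2 + w3 * u3 ->
  b <= u1 -> u2 <= b -> u3 <= b ->
  two_atoms E b (w1 * y1 + w2 * y2 + w3 * y3).
Proof.
move=> E1 E2 E3 p1 p2 p3 ws bE b1 b2 b3.
have := @three_atoms_side (fun u => E (- u)) (- u1) y1 (- u2) y2 (- u3) y3
  w1 w2 w3 (- b).
rewrite !opprK => /(_ E1 E2 E3 p1 p2 p3 ws ltac:(lra) ltac:(lra) ltac:(lra)
  ltac:(lra)) [w [v1 [z1 [v2 [z2 [? ? ? ? ?]]]]]].
by exists w, (- v1), z1, (- v2), z2; split => //; lra.
Qed.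

Lemma three_atoms E u1 y1 u2 y2 u3 y3 w1 w2 w3 :
  E u1 y1 -> E u2 y2 -> E u3 y3 -> 0 <= w1 -> 0 <= w2 -> 0 <= w3 ->
  w1 + w2 + w3 = 1 ->
  two_atoms E (w1 * u1 + w2 * u2 + w3 * u3) (w1 * y1 + w2 * y2 + w3 * y3).
Proof.
move=> E1 E2 E3 p1 p2 p3 ws.
have [b bE] : exists b : R, b = w1 * u1 + w2 * u2 + w3 * u3.
  by exists (w1 * u1 + w2 * u2 + w3 * u3).
rewrite -bE.
have y213 : w1 * y1 + w2 * y2 + w3 * y3 = w2 * y2 + w1 * y1 + w3 * y3 by lra.
have y312 : w1 * y1 + w2 * y2 + w3 * y3 = w3 * y3 + w1 * y1 + w2 * y2 by lra.
have bal : w1 * (u1 - b) + w2 * (u2 - b) + w3 * (u3 - b) = 0.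
  have -> : w1 * (u1 - b) + w2 * (u2 - b) + w3 * (u3 - b) =
     (w1 * u1 + w2 * u2 + w3 * u3) - (w1 + w2 + w3) * b by ring.
  by rewrite ws -bE; ring.
have balance0 (d1 d2 d3 : R) : 0 < d1 -> 0 < d2 -> 0 < d3 ->
    w1 * d1 + w2 * d2 + w3 * d3 != 0.
  move=> h1 h2 h3; apply/eqP => H.
  have g1 := mulr_ge0 p1 (ltW h1); have g2 := mulr_ge0 p2 (ltW h2).
  have g3 := mulr_ge0 p3 (ltW h3).
  have : w1 * d1 = 0 by lra.
  have : w2 * d2 = 0 by lra.
  have : w3 * d3 = 0 by lra.
  move=> /eqP; rewrite mulf_eq0 (gt_eqF h3) orbF => /eqP e3.
  move=> /eqP; rewrite mulf_eq0 (gt_eqF h2) orbF => /eqP e2.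
  move=> /eqP; rewrite mulf_eq0 (gt_eqF h1) orbF => /eqP e1.
  lra.
have [l1|l1] := leP u1 b; have [l2|l2] := leP u2 b; have [l3|l3] := leP u3 b.
- have [e1|e1] := leP b u1; first by apply: three_atoms_side_opp E1 E2 E3 _ _ _ _ _ _ _ _.
  have [e2|e2] := leP b u2.
    by rewrite y213; apply: three_atoms_side_opp E2 E1 E3 _ _ _ _ _ _ _ _ => //; lra.
  have [e3|e3] := leP b u3.
    by rewrite y312; apply: three_atoms_side_opp E3 E1 E2 _ _ _ _ _ _ _ _ => //; lra.
  exfalso.
  have /eqP := balance0 (b - u1) (b - u2) (b - u3) ltac:(lra) ltac:(lra) ltac:(lra).
  lra.
- by rewrite y312; apply: three_atoms_side_opp E3 E1 E2 _ _ _ _ _ _ _ _ => //; lra.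
- by rewrite y213; apply: three_atoms_side_opp E2 E1 E3 _ _ _ _ _ _ _ _ => //; lra.
- by apply: three_atoms_side E1 E2 E3 _ _ _ _ _ _ _ _ => //; lra.
- by apply: three_atoms_side_opp E1 E2 E3 _ _ _ _ _ _ _ _ => //; lra.
- by rewrite y213; apply: three_atoms_side E2 E1 E3 _ _ _ _ _ _ _ _ => //; lra.
- by rewrite y312; apply: three_atoms_side E3 E1 E2 _ _ _ _ _ _ _ _ => //; lra.
- exfalso.
  have /eqP := balance0 (u1 - b) (u2 - b) (u3 - b) ltac:(lra) ltac:(lra) ltac:(lra).
  lra.
Qed.

Lemma two_atoms_convex E b y b' y' t :
  two_atoms E b y -> two_atoms E b' y' -> 0 <= t <= 1 ->
  two_atoms E (t * b + (1 - t) * b') (t * y + (1 - t) * y').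
Proof.
move=> [w [u1 [y1 [u2 [y2 [hw E1 E2 bE yE]]]]]].
move=> H' ht; have [v [u3 [y3 [u4 [y4 [hv E3 E4 b'E y'E]]]]]] := H'.
set S := t + (1 - t) * v.
have S0 : 0 <= S by rewrite /S; nra.
have [SE|Sn] := eqVneq S 0.
  have t0 : t = 0 by rewrite /S in SE; nra.
  by rewrite t0 !mul0r !add0r subr0 !mul1r.
have Sp : 0 < S by rewrite lt_neqAle eq_sym Sn.
have S1 : S <= 1 by rewrite /S; nra.
have := three_atoms (w1 := t * w / S) (w2 := t * (1 - w) / S)
  (w3 := (1 - t) * v / S) E1 E2 E3.
have -> : 0 <= t * w / S by rewrite divr_ge0 ?mulr_ge0 //; lra.
have -> : 0 <= t * (1 - w) / S by rewrite divr_ge0 ?mulr_ge0 //; lra.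
have -> : 0 <= (1 - t) * v / S by rewrite divr_ge0 ?mulr_ge0 //; lra.
have -> : t * w / S + t * (1 - w) / S + (1 - t) * v / S = 1.
  by rewrite -!mulrDl -[RHS](divff Sn) /S; congr (_ / _); ring.
move=> /(_ isT isT isT erefl) [x [v1 [z1 [v2 [z2 [hx F1 F2 vE zE]]]]]].
have := three_atoms (w1 := S * x) (w2 := S * (1 - x))
  (w3 := (1 - t) * (1 - v)) F1 F2 E4.
have -> : 0 <= S * x by rewrite mulr_ge0 //; lra.
have -> : 0 <= S * (1 - x) by rewrite mulr_ge0 //; lra.
have -> : 0 <= (1 - t) * (1 - v) by rewrite mulr_ge0 //; lra.
have -> : S * x + S * (1 - x) + (1 - t) * (1 - v) = 1 by rewrite /S; ring.
move=> /(_ isT isT isT erefl).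
have scale (p1 p2 p3 : R) : S * (t * w / S * p1 + t * (1 - w) / S * p2 +
    (1 - t) * v / S * p3) = t * (w * p1 + (1 - w) * p2) + (1 - t) * v * p3.
  by field.
have -> : S * x * v1 + S * (1 - x) * v2 + (1 - t) * (1 - v) * u4 =
    t * b + (1 - t) * b'.
  rewrite bE b'E.
  have -> : S * x * v1 + S * (1 - x) * v2 = S * (x * v1 + (1 - x) * v2) by ring.
  by rewrite -vE scale; ring.
apply: two_atoms_le.
have -> : S * x * z1 + S * (1 - x) * z2 = S * (x * z1 + (1 - x) * z2) by ring.
move: zE; rewrite -(ler_pM2l Sp) scale => zE.
have : t * y <= t * (w * y1 + (1 - w) * y2) by apply: ler_wpM2l; lra.
have : (1 - t) * y' <= (1 - t) * (v * y3 + (1 - v) * y4).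
  by apply: ler_wpM2l; lra.
lra.
Qed.

End TwoAtoms.

Section Hull.
Context (R : realType) (K : nat) (h : 'I_K -> R -> R) (L M s r q W : R).
Hypotheses (k0 : 'I_K) (U : forall k, utility (h k) L M s r)
  (ex : exponents L M s r q W).

Definition below_utility (u y : R) : Prop := 0 <= u /\ exists k, y <= h k u.

Definition hull (b : R) := sup [set y | two_atoms below_utility b y].

Lemma hull_has_sup b : 0 <= b -> has_sup [set y | two_atoms below_utility b y].
Proof.
move=> b0; split.
  exists (h k0 b), 1, b, (h k0 b), b, (h k0 b).
  by split; [lra|split => //; exists k0|split => //; exists k0|lra|lra].
have [L0 M0 s01 r01 q0 qs qr W1] := ex.
exists (M * (2 + b)) => y [w [u1 [y1 [u2 [y2 [hw [p1 [k1 e1]] [p2 [k2 e2]] -> yE]]]]]].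
have r1 : 0 <= r <= 1 by lra.
have bnd k u : 0 <= u -> h k u <= M * (2 + u).
  move=> u0; apply: (le_trans (util_growth (U k) u0)); apply: ler_wpM2l => //.
  by have := powR_le1D u0 r1; lra.
have := bnd k1 _ p1; have := bnd k2 _ p2 => g2 g1.
have : w * y1 <= w * (M * (2 + u1)) by apply: ler_wpM2l; lra.
have : (1 - w) * y2 <= (1 - w) * (M * (2 + u2)) by apply: ler_wpM2l; lra.
lra.
Qed.

Lemma hull_ge b y : 0 <= b -> two_atoms below_utility b y -> y <= hull b.
Proof. by move=> b0 hy; apply: sup_upper_bound => //; exact: hull_has_sup. Qed.

Lemma hull_ge_mixture w k1 u1 k2 u2 : 0 <= w <= 1 -> 0 <= u1 -> 0 <= u2 ->
  w * h k1 u1 + (1 - w) * h k2 u2 <= hull (w * u1 + (1 - w) * u2).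
Proof.
move=> hw p1 p2; apply: hull_ge.
  by rewrite addr_ge0 ?mulr_ge0 //; lra.
exists w, u1, (h k1 u1), u2, (h k2 u2).
by split => //; split => //; [exists k1|exists k2].
Qed.

Lemma hull_ge_pure k b : 0 <= b -> h k b <= hull b.
Proof.
move=> b0; have := @hull_ge_mixture 1 k b k b ltac:(lra) b0 b0.
by rewrite subrr !mul1r !mul0r !addr0.
Qed.

Lemma hull_le b y : 0 <= b ->
  (forall w k1 u1 k2 u2, 0 <= w <= 1 -> 0 <= u1 -> 0 <= u2 ->
     b = w * u1 + (1 - w) * u2 -> w * h k1 u1 + (1 - w) * h k2 u2 <= y) ->
  hull b <= y.
Proof.
move=> b0 hy; apply: ge_sup; first by have [] := hull_has_sup b0.
move=> z [w [u1 [y1 [u2 [y2 [hw [p1 [k1 e1]] [p2 [k2 e2]] bE yE]]]]]].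
apply: le_trans (hy w k1 u1 k2 u2 hw p1 p2 bE); apply: (le_trans yE).
by apply: lerD; apply: ler_wpM2l; lra.
Qed.

Lemma hull_concave : concave_on (@nonneg_real R) hull.
Proof.
move=> b b' t b0 b'0 ht; rewrite /nonneg_real in b0 b'0.
have c0 : 0 <= t * b + (1 - t) * b' by rewrite addr_ge0 ?mulr_ge0 //; lra.
apply/ler_addgt0Pr => e e0.
have [y hy H] := sup_adherent e0 (hull_has_sup b0).
have [y' hy' H'] := sup_adherent e0 (hull_has_sup b'0).
have := hull_ge c0 (two_atoms_convex hy hy' ht).
rewrite -/(hull b) in H; rewrite -/(hull b') in H'.
have : t * (hull b - e) <= t * y by apply: ler_wpM2l; lra.
have : (1 - t) * (hull b' - e) <= (1 - t) * y' by apply: ler_wpM2l; lra.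
lra.
Qed.

Lemma hull_mono b b' : 0 <= b <= b' -> hull b <= hull b'.
Proof.
move=> hb; apply: hull_le => [|w k1 u1 k2 u2 hw p1 p2 bE]; first lra.
have := @hull_ge_mixture w k1 (u1 + (b' - b)) k2 (u2 + (b' - b)) hw
  ltac:(lra) ltac:(lra).
have -> : w * (u1 + (b' - b)) + (1 - w) * (u2 + (b' - b)) = b'.
  by rewrite [b in _ - b]bE; ring.
apply: le_trans; apply: lerD; apply: ler_wpM2l; try lra;
  by apply: (util_mono (U _)); lra.
Qed.

Lemma hull_root d : 0 <= d -> hull d <= hull 0 + 2 * L * d `^ s.
Proof.
move=> d0; apply: hull_le => // w k1 u1 k2 u2 hw p1 p2 dE.
have [L0 M0 s01 r01 q0 qs qr W1] := ex.
have := @hull_ge_mixture w k1 0 k2 0 hw (lexx _) (lexx _).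
rewrite !mulr0 addr0.
have part k v u : 0 <= v <= 1 -> 0 <= u -> v * u <= d ->
    v * h k u <= v * h k 0 + L * d `^ s.
  move=> hv u0 vu; have ru := util_root (U k) u0.
  have : v * h k u <= v * (h k 0 + L * u `^ s) by apply: ler_wpM2l; lra.
  move=> /le_trans; apply; rewrite mulrDr lerD2l mulrCA ler_wpM2l //.
  apply: (le_trans (weight_powR hv u0 s01)).
  by apply: ge0_ler_powR; rewrite ?nnegrE ?mulr_ge0 //; lra.
have q1 : 0 <= w * u1 by rewrite mulr_ge0 //; lra.
have q2 : 0 <= (1 - w) * u2 by rewrite mulr_ge0 //; lra.
have := part k1 w u1 hw p1 ltac:(lra).
have := part k2 (1 - w) u2 ltac:(lra) p2 ltac:(lra).
lra.
Qed.

Lemma hull_holder x y : 0 <= x <= W -> 0 <= y <= W ->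
  hull x - hull y <= 2 * L * W * `|x - y| `^ q.
Proof.
have [L0 M0 s01 r01 q0 qs qr W1] := ex.
move=> hx hy; have [xy|yx] := leP x y.
  have := @hull_mono x y ltac:(lra).
  have : 0 <= 2 * L * W * `|x - y| `^ q.
    by rewrite !mulr_ge0 ?powR_ge0 //; lra.
  lra.
rewrite gtr0_norm; last lra.
have := concave_on_increment hull_concave (x := y) (y := x) (lexx _).
rewrite /nonneg_real => /(_ ltac:(lra) ltac:(lra)).
have := @hull_root (x - y) ltac:(lra).
have : 2 * L * (x - y) `^ s <= 2 * L * W * (x - y) `^ q.
  rewrite -[leRHS]mulrA; apply: ler_wpM2l; first by rewrite mulr_ge0.
  by apply: powR_le_mul => //; lra.
lra.
Qed.

End Hull.

(** * Running the algorithms *)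

Lemma mean_limit (R : realType) (x y z : R) :
  (forall al, open_unit al -> al * x + (1 - al) * y <= z) -> x <= z.
Proof.
move=> H; apply/ler_addgt0Pr => e e0.
have [xy|yx] := leP x y.
  by have := H (1 / 2); rewrite /open_unit => /(_ ltac:(lra)); lra.
set D := 1 + (x - y).
have D0 : 0 < D by rewrite /D; lra.
set a := Num.min (1 / 2) (e / D).
have a0 : 0 < a by rewrite lt_min (divr_gt0 e0 D0) andbT; lra.
have a1 : a <= 1 / 2 by rewrite ge_min lexx.
have aD : a * D <= e by rewrite -ler_pdivlMr // ge_min lexx orbT.
have := H (1 - a); rewrite /open_unit => /(_ ltac:(lra)).
have : a * D = a + a * (x - y) by rewrite /D; ring.
lra.
Qed.

Section Algorithms.
Context (R : realType) (n m K N : nat) (pb : problem R n m K N).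
Context (wco : oracle R m K) (eps eta : R) (i : 'I_N).
Context (h : 'I_K -> R -> R) (L M s r q W H0 Ec : R) (J : nat).
Hypotheses (U : forall k, utility (h k) L M s r) (ex : exponents L M s r q W).
Hypotheses (hH0 : forall k, `|h k 0| <= H0).
Hypotheses (eps0 : 0 < eps) (eta0 : 0 < eta) (Ec0 : 0 <= Ec).
Hypothesis HJ : phi R ^+ J * W <= eta.
Hypothesis wcoP : forall k u, 0 <= u -> exists Lh v t,
  [/\ wco eps k (zhat pb i) u = Some ((Lh, v), t), t <= Ec &
      h k u - eps <= Lh <= h k u].

Let phi_pow_le (w : R) : w <= W -> phi R ^+ J * w <= eta.
Proof.
move=> wW; apply: le_trans HJ; apply: ler_wpM2l => //.
by apply: exprn_ge0; have := phi_bounds R; lra.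
Qed.

Let C1 := L * W.
Let C2 := 2 * (H0 + M * (2 + W)).
Let T1 := J.+2%:R * (2 * (2 * Ec + 1) + 2).
Let T2 := J.+2%:R * (2 * T1 + 2).
Let e1 := 3 * eps + C1 * eta `^ q.
Let e2 := 3 * e1 + C2 * eta `^ q.

Lemma inner_solver_spec k1 k2 b al : 0 <= b <= W -> open_unit al ->
  exists v sp t, [/\ inner_solver pb wco eps eta i k1 k2 b al = Some ((v, sp), t),
    t <= T1 & split_sup (h k1) (h k2) b al - e1 <= v <= split_sup (h k1) (h k2) b al].
Proof.
move=> hb hal; have [L0 M0 s01 r01 q0 qs qr W1] := ex.
have b0 : 0 <= b by lra.
have E0 : 0 <= 2 * Ec + 1 by move: Ec0; lra.
have C10 : 0 <= L * W by rewrite mulr_ge0 //; lra.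
have inD (y : R) : 0 <= y <= b -> (0 < b -> 0 < y < b) -> 0 <= y <= b by [].
have hJ : phi R ^+ J * (b - 0) <= eta by apply: phi_pow_le; lra.
have eP y : 0 <= y <= b -> exists v a t,
  [/\ (let* r1 := wco eps k1 (zhat pb i) (y / al) in
       let* r2 := wco eps k2 (zhat pb i) ((b - y) / (1 - al)) in
       let* _ := tick R in
       ret R (al * r1.1 + (1 - al) * r2.1,
              SplitPoint al (1 - al) y (b - y) r1.2 r2.2)) = Some ((v, a), t),
      t <= 2 * Ec + 1 &
      split_value (h k1) (h k2) b al y - eps <= v <=
        split_value (h k1) (h k2) b al y].
  move=> hy; rewrite /open_unit in hal.
  have [l1 [v1 [t1 [-> ht1 b1]]]] := @wcoP k1 (y / al) ltac:(rewrite divr_ge0 //; lra).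
  have [l2 [v2 [t2 [-> ht2 b2]]]] := @wcoP k2 ((b - y) / (1 - al))
    ltac:(rewrite divr_ge0 //; lra).
  do 3 eexists; split; first by []; first lra.
  move: b1 b2 => /= /andP[b1 b1'] /andP[b2 b2']; rewrite /split_value.
  have : al * l1 <= al * h k1 (y / al) by apply: ler_wpM2l; lra.
  have : al * (h k1 (y / al) - eps) <= al * l1 by apply: ler_wpM2l; lra.
  have : (1 - al) * l2 <= (1 - al) * h k2 ((b - y) / (1 - al)).
    by apply: ler_wpM2l; lra.
  have : (1 - al) * (h k2 ((b - y) / (1 - al)) - eps) <= (1 - al) * l2.
    by apply: ler_wpM2l; lra.
  lra.
have [v [a [t [Hg Ht [y hy vy] Hx]]]] := golden_spec eta0 E0 (ltW eps0) C10
  q0 b0 inD (fun y hy => hy)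
  (split_value_concave_budget (U k1) (U k2) hal)
  (fun x y hx hy => split_value_holder_budget (U k1) (U k2) ex hb hal hx hy)
  eP hJ.
exists v, a, t; split => //; apply/andP; split.
  rewrite lerBlDr; apply: (split_sup_le (U k1) (U k2) hb hal) => be hbe.
  by have := Hx _ hbe; rewrite /e1 /C1; lra.
by apply: (le_trans vy); apply: (split_sup_ge (U k1) (U k2) hb hal).
Qed.

Definition pair_bound k1 k2 b v := forall al be, open_unit al -> 0 <= be <= b ->
  split_value (h k1) (h k2) b al be <= v.

Lemma pair_eval_spec k1 k2 b : 0 <= b <= W ->
  exists v sp t, [/\ pair_eval pb wco eps eta i k1 k2 b = Some ((v, sp), t),
    t <= T2, pair_bound k1 k2 b (v + e2) &
    exists2 al, open_unit al & v <= split_sup (h k1) (h k2) b al].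
Proof.
move=> hb; have [L0 M0 s01 r01 q0 qs qr W1] := ex.
have E0 : 0 <= T1.
  by rewrite /T1 mulr_ge0 //; move: Ec0; lra.
have C20 : 0 <= C2.
  rewrite /C2 mulr_ge0 // addr_ge0 //; last by rewrite mulr_ge0 //; lra.
  exact: le_trans (hH0 k1).
have e10 : 0 <= e1.
  rewrite /e1 addr_ge0 //; first by move: eps0; lra.
  by rewrite !mulr_ge0 ?powR_ge0 //; lra.
have inD (y : R) : 0 <= y <= 1 -> ((0 : R) < 1 -> 0 < y < 1) -> open_unit y.
  by move=> _; apply; exact: ltr01.
have subD y : open_unit y -> (0 : R) <= y <= 1 by rewrite /open_unit; lra.
have hJ : phi R ^+ J * (1 - 0) <= eta by apply: phi_pow_le; lra.
have [v [a [t [Hg Ht [y hy vy] Hx]]]] := golden_spec eta0 E0 e10 C20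
  q0 ler01 inD subD
  (split_sup_concave (U k1) (U k2) hb)
  (fun x y hx hy => split_sup_holder (U k1) (U k2) ex hb hx hy (hH0 k1) (hH0 k2))
  (fun y => @inner_solver_spec k1 k2 b y hb) hJ.
exists v, a, t; split => //; last by exists y.
move=> al be hal hbe.
have := split_sup_ge (U k1) (U k2) hb hal hbe.
by have := Hx _ hal; rewrite /e2; lra.
Qed.

Lemma split_sup_le_hull k1 k2 b al : 0 <= b <= W -> open_unit al ->
  split_sup (h k1) (h k2) b al <= hull h b.
Proof.
move=> hb hal; apply: (split_sup_le (U k1) (U k2) hb hal) => be hbe.
rewrite /split_value; rewrite /open_unit in hal.
have := @hull_ge_mixture _ _ h L M s r q W k1 U ex al k1 (be / al) k2
  ((b - be) / (1 - al)).
have -> : al * (be / al) + (1 - al) * ((b - be) / (1 - al)) = b.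
  by field; apply/andP; split; rewrite gt_eqF //; lra.
by apply; [lra|rewrite divr_ge0 //; lra|rewrite divr_ge0 //; lra].
Qed.

Lemma best_pair_spec kk kks b : 0 <= b <= W ->
  exists (o : local_output R m K) t,
  [/\ best_pair pb wco eps eta i b kk kks = Some (o, t),
    t <= (size kks).+1%:R * (T2 + 1), o.1.1 <= hull h b &
    forall kk', kk' \in kk :: kks -> pair_bound kk'.1 kk'.2 b (o.1.1 + e2)].
Proof.
move=> hb; elim: kks kk => [|kk' kks IH] kk /=;
  have [v [sp [t [-> ht hv [al hal le]]]]] := pair_eval_spec kk.1 kk.2 hb;
  have vh := le_trans le (split_sup_le_hull kk.1 kk.2 hb hal); rewrite /=.
  exists ((v, sp), kk), (t + (1 + 0)); split => //; first lra.
  by move=> k; rewrite inE => /eqP ->.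
have [out [t' [-> ht' vh' hv']]] := IH kk'; rewrite /=.
exists (if v < out.1.1 then out else (v, sp, kk)), (t + (1 + (t' + 0))).
split => //; first by rewrite -[(size kks).+2%:R]natr1; lra.
  by case: ifP.
move=> k; rewrite inE => /orP[/eqP ->|/hv' hk] al' be' hal' hbe'.
  have := hv al' be' hal' hbe'; case: ifPn => // lt; lra.
have := hk al' be' hal' hbe'; case: ifPn => //; rewrite -leNgt /=; lra.
Qed.

Let T3 := K%:R ^+ 2 * (T2 + 1).

Hypothesis K2 : (2 <= K)%N.

Lemma local_eval_spec b : 0 <= b <= W ->
  exists (o : local_output R m K) t,
  [/\ local_eval pb wco eps eta i b = Some (o, t), t <= T3 &
    hull h b - e2 <= o.1.1 <= hull h b].
Proof.
move=> hb; rewrite /local_eval.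
have inP (kk : 'I_K * 'I_K) : (kk \in index_pairs K) = (kk.1 < kk.2)%N.
  by rewrite mem_filter mem_enum andbT.
have sizeP : (size (index_pairs K) <= K ^ 2)%N.
  rewrite size_filter (leq_trans (count_size _ _)) // -cardE card_prod card_ord.
  by rewrite -mulnn.
pose k0 : 'I_K := Ordinal (ltnW K2); pose k1 : 'I_K := Ordinal K2.
have : (k0, k1) \in index_pairs K by rewrite inP.
case: (index_pairs K) inP sizeP => [//|kk kks] inP sizeP _.
have [out [t [Ho Ht Hle Hb]]] := best_pair_spec kk kks hb.
exists out, t; split => //.
  apply: (le_trans Ht); rewrite /T3 ler_wpM2r //.
    rewrite /T2 /T1 addr_ge0 // mulr_ge0 // addr_ge0 // mulr_ge0 //.
    by rewrite mulr_ge0 //; move: Ec0; lra.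
  by rewrite -natrX ler_nat.
rewrite Hle andbT lerBlDr.
have b0 : 0 <= b by lra.
have pairP (k k' : 'I_K) : (k < k')%N -> pair_bound k k' b (out.1.1 + e2).
  by move=> kk'; apply: (Hb (k, k')); rewrite inP.
have split_even k k' al : open_unit al ->
    split_value (h k) (h k') b al (al * b) = al * h k b + (1 - al) * h k' b.
  rewrite /open_unit /split_value => hal.
  have -> : al * b / al = b by field; rewrite gt_eqF //; lra.
  have -> // : (b - al * b) / (1 - al) = b.
  by field; rewrite gt_eqF //; lra.
have evenP al : open_unit al -> 0 <= al * b <= b.
  by move=> /andP[a0 a1]; rewrite mulr_ge0 ?(ltW a0) //= ler_piMl // ltW.
have pure k : h k b <= out.1.1 + e2.
  have [k' kk'] : exists k' : 'I_K, k' != k.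
    have [->|kk0] := eqVneq k k0; first by exists k1.
    by exists k0; rewrite eq_sym.
  apply: (@mean_limit _ _ (h k' b)) => al hal.
  have hal' : open_unit (1 - al) by move: hal; rewrite /open_unit; lra.
  have [lt|gt|/val_inj eq] := ltngtP k k'.
  - by rewrite -split_even //; apply: pairP => //; exact: evenP.
  - have := pairP _ _ gt (1 - al) ((1 - al) * b) hal' (evenP _ hal').
    by rewrite split_even //; lra.
  - by rewrite eq eqxx in kk'.
apply: (hull_le k0 U ex b0) => w k u k' u' hw u0 u'0 bE.
have [lt_w|] := boolP (0 < w < 1); last first.
  rewrite negb_and -!leNgt => /orP[w0|w1].
    have w0' : w = 0 by lra.
    move: bE; rewrite w0' !mul0r !add0r subr0 !mul1r => <-; exact: pure.
  have w1' : w = 1 by lra.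
  by move: bE; rewrite w1' subrr !mul1r !mul0r !addr0 => <-; exact: pure.
have [w0 w1] := andP lt_w.
have wu : 0 <= w * u <= b.
  rewrite mulr_ge0 ?(ltW w0) //= bE lerDl mulr_ge0 //; lra.
have w'u : 0 <= (1 - w) * u' <= b.
  rewrite mulr_ge0 //=; last lra.
  by rewrite bE lerDr mulr_ge0 //; lra.
have wE x : w * x / w = x by field; rewrite gt_eqF.
have w'E x : (1 - w) * x / (1 - w) = x by field; rewrite gt_eqF //; lra.
have [lt|gt|/val_inj eq] := ltngtP k k'.
- have := pairP _ _ lt w (w * u) lt_w wu; rewrite /split_value.
  have -> : b - w * u = (1 - w) * u' by lra.
  by rewrite wE w'E.
- have hw' : open_unit (1 - w) by rewrite /open_unit; lra.
  have := pairP _ _ gt (1 - w) ((1 - w) * u') hw' w'u; rewrite /split_value.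
  have -> : b - (1 - w) * u' = w * u by lra.
  have -> : 1 - (1 - w) = w by ring.
  by rewrite wE w'E addrC.
- rewrite -eq; apply: le_trans (pure k); rewrite bE.
  exact: (util_concave (U k)).
Qed.

Context (lam : R) (lam0 : 0 <= lam) (rhoW : 0 <= N%:R * rho pb <= W).

Let U0 := N%:R * rho pb.
Let C3 := 2 * L * W + lam * W.
Let f b := hull h b - lam * b.
Let D b : Prop := 0 <= b <= U0.

Let f_concave : concave_on D f.
Proof.
move=> x y t Dx Dy ht; have k0 : 'I_K := Ordinal K2.
have := hull_concave k0 U ex (x := x) (y := y) (t := t).
rewrite /nonneg_real; move: Dx Dy => /andP[x0 _] /andP[y0 _] /(_ x0 y0 ht).
rewrite /f; lra.
Qed.

Let f_holder x y : D x -> D y -> f x - f y <= C3 * `|x - y| `^ q.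
Proof.
have [L0 M0 s01 r01 q0 qs qr W1] := ex; have hW := rhoW.
move=> Dx Dy; have k0 : 'I_K := Ordinal K2.
have hx : 0 <= x <= W by move: Dx; rewrite /D /U0; lra.
have hy : 0 <= y <= W by move: Dy; rewrite /D /U0; lra.
have := hull_holder k0 U ex hx hy.
have : lam * `|x - y| <= lam * (W * `|x - y| `^ q).
  apply: ler_wpM2l => //; rewrite -[leLHS]powRr1 //.
  apply: powR_le_mul => //; last lra.
  by rewrite normr_ge0 /= ler_norml; lra.
have : lam * (y - x) <= lam * `|x - y|.
  by apply: ler_wpM2l => //; rewrite distrC ler_norm.
rewrite /f /C3; lra.
Qed.

Let budget_inv (j : nat) (st : budget_state R) :=
  [/\ [/\ 0 <= bL st, bL st <= bU st, bU st <= U0, 0 < U0 -> bL st < bU st &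
        phi R ^+ j * (bU st - bL st) <= eta],
      b1 st = lower_point (bL st) (bU st), b2 st = upper_point (bL st) (bU st),
      hull h (b1 st) - e2 <= bV1 st <= hull h (b1 st) /\
      hull h (b2 st) - e2 <= bV2 st <= hull h (b2 st) &
      forall x, D x -> bL st <= x <= bU st \/
        f x <= Num.max (bV1 st - lam * b1 st) (bV2 st - lam * b2 st) + 3 * e2].

Let D_interior y : 0 <= y <= U0 -> (0 < U0 -> 0 < y < U0) -> D y.
Proof. by []. Qed.

Let e2_ge0 : 0 <= e2.
Proof.
have [L0 M0 s01 r01 q0 qs qr W1] := ex.
have k0 : 'I_K := Ordinal K2; have H00 := le_trans (normr_ge0 _) (hH0 k0).
rewrite /e2 /e1 /C1 /C2; move: eps0 => e0.
have : 0 <= L * W * eta `^ q by rewrite !mulr_ge0 ?powR_ge0 //; lra.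
have : 0 <= 2 * (H0 + M * (2 + W)) * eta `^ q.
  by rewrite mulr_ge0 ?powR_ge0 // mulr_ge0 // addr_ge0 // mulr_ge0 //; lra.
lra.
Qed.

Let budget_step_inv j st : budget_inv j.+1 st ->
  exists st' t, [/\ budget_step pb wco eps eta i lam st = Some (st', t),
    budget_inv j st' & t <= T3].
Proof.
case: st => lo up c1 c2 v1 v2; rewrite /budget_inv /=; case => hI -> -> [B1 B2] hx.
have [h1 h2 h3 h4 h5] := hI.
have [a b c e] := lower_upper_bounds h2.
have [D1 D2] := golden_points D_interior h1 h2 h3 h4.
have hW := rhoW.
have prune x (Dx : D x) := golden_prune e2_ge0 f_concave Dx D1 D2
  (v1 := v1 - lam * lower_point lo up) (v2 := v2 - lam * upper_point lo up)
  ltac:(rewrite /f; lra) ltac:(rewrite /f; lra) (hx x Dx) (lexx _).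
rewrite /budget_step /=.
move: prune; case: ifPn => lt prune.
  have [a' b' c' e'] := lower_upper_bounds (le_trans b c).
  have [out [t [-> Ht Ho]]] := @local_eval_spec
    (upper_point (lower_point lo up) up) ltac:(rewrite -/U0 in hW; lra).
  do 2 eexists; split; first by []; last by rewrite addr0.
  split => //=.
  - split => //; first [by rewrite width_lower mulrA -exprSr|by move=> /h4 /e; lra|lra].
  - by rewrite lower_point_shift.
  - move=> x Dx; case: (prune x Dx) => hh; first by left.
    right; apply: (le_trans hh); rewrite lerD2r.
    have -> : Num.max (v1 - lam * lower_point lo up)
      (v2 - lam * upper_point lo up) = v2 - lam * upper_point lo up.
      by apply/max_idPr/ltW.
    by rewrite le_max lexx.
have [a' b' c' e'] := lower_upper_bounds (le_trans a b).
have [out [t [-> Ht Ho]]] := @local_eval_spec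
  (lower_point lo (upper_point lo up)) ltac:(rewrite -/U0 in hW; lra).
do 2 eexists; split; first by []; last by rewrite addr0.
split => //=.
- split => //; first [by rewrite width_upper mulrA -exprSr|by move=> /h4 /e; lra|lra].
- by rewrite upper_point_shift.
- move=> x Dx; case: (prune x Dx) => hh; first by left.
  right; apply: (le_trans hh); rewrite lerD2r.
  have -> : Num.max (v1 - lam * lower_point lo up)
    (v2 - lam * upper_point lo up) = v1 - lam * lower_point lo up.
    by apply/max_idPl; rewrite leNgt.
  by rewrite le_max lexx orbT.
Qed.

Theorem budget_eval_spec : exists bhat (o : local_output R m K) t,
  [/\ budget_eval pb wco eps eta i lam = Some ((bhat, o), t),
    t <= J.+3%:R * (T3 + 1) &
    forall b, 0 <= b <= U0 ->
      hull h b - lam * b <= o.1.1 - lam * bhat + (4 * e2 + C3 * eta `^ q)].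
Proof.
have [L0 M0 s01 r01 q0 qs qr W1] := ex; have hW := rhoW.
have U00 : 0 <= U0 by rewrite /U0; lra.
have [a b c e] := lower_upper_bounds U00.
have [out1 [t1 [E1 Ht1 B1]]] := @local_eval_spec (lower_point 0 U0)
  ltac:(rewrite -/U0 in hW; lra).
have [out2 [t2 [E2 Ht2 B2]]] := @local_eval_spec (upper_point 0 U0)
  ltac:(rewrite -/U0 in hW; lra).
have invJ : budget_inv J (BudgetState 0 U0 (lower_point 0 U0)
    (upper_point 0 U0) out1.1.1 out2.1.1).
  split => //=; last by left.
  by split => //; apply: phi_pow_le; rewrite /U0; lra.
have guard0 st : budget_inv 0 st -> ~~ (eta < bU st - bL st).
  by case=> -[_ _ _ _]; rewrite expr0 mul1r -leNgt.
have bodyP j st : budget_inv j.+1 st -> eta < bU st - bL st -> exists st' t,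
    [/\ budget_step pb wco eps eta i lam st = Some (st', t), budget_inv j st' &
      t <= T3].
  by move=> hi _; exact: budget_step_inv.
have T30 : 0 <= T3.
  have e0 := Ec0.
  rewrite /T3 /T2 /T1 mulr_ge0 ?exprn_ge0 // addr_ge0 // mulr_ge0 // addr_ge0 //.
  by rewrite mulr_ge0 // mulr_ge0 //; lra.
have [ [lo up c1 c2 v1 v2] [t [j [Hw Hi Hg Ht]]]] :=
  while_spec guard0 bodyP T30 invJ.
move: Hi Hg; rewrite /budget_inv /= -leNgt => -[[h1 h2 h3 h4 h5] -> -> [B3 B4] hx] hLU.
have [a' b' c' e'] := lower_upper_bounds h2.
have [out [t' [E3 Ht3 B5]]] := @local_eval_spec lo ltac:(rewrite -/U0 in hW; lra).
exists lo, out, (t1 + (t2 + (t + (t' + 0)))); split.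
- by rewrite /budget_eval -/U0 E1 /= E2 /= Hw /= E3.
- rewrite -[J.+3%:R]natr1 -[J.+2%:R]natr1; move: Ht.
  rewrite -[J.+1%:R]natr1; lra.
clear invJ guard0 bodyP Hw E1 E2 E3 Ht Ht1 Ht2 Ht3 B1 B2 T30 hW s01 r01 qs qr.
have Dlo : D lo by rewrite /D h1 /= (le_trans h2).
have close y : D y -> lo <= y <= up -> f y <= f lo + C3 * eta `^ q.
  move=> Dy hy; have le : lo <= lo <= up by lra.
  have C30 : 0 <= C3.
    have W0 := le_trans ler01 W1.
    by rewrite /C3 addr_ge0 // mulr_ge0 // mulr_ge0.
  have := holder_close eta0 C30 q0 f_holder Dy Dlo hy le hLU; lra.
have e20 := e2_ge0.
move=> x Dx; rewrite -/(f x).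
have fin : f x <= f lo + C3 * eta `^ q + 3 * e2.
  case: (hx x Dx) => [hh|hh]; first by have := close x Dx hh; lra.
  apply: (le_trans hh); rewrite lerD2r ge_max.
  have := close (lower_point lo up) ltac:(rewrite /D; lra) ltac:(lra).
  have := close (upper_point lo up) ltac:(rewrite /D; lra) ltac:(lra).
  rewrite /f; lra.
by move: fin; rewrite /f; lra.
Qed.

End Algorithms.

(** * Norms and concave functions on row vectors *)

Section NormEquivalence.
Context (R : realType) (m : nat) (nrm : 'rV[R]_m -> R).
Hypothesis nrmP : is_norm nrm.

Lemma is_norm0 : nrm 0 = 0.
Proof. by rewrite -(scale0r 0) (nrm_scale nrmP) normr0 mul0r. Qed.

Lemma is_normN v : nrm (- v) = nrm v.
Proof. by rewrite -scaleN1r (nrm_scale nrmP) normrN1 mul1r. Qed.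

Lemma is_norm_ge0 v : 0 <= nrm v.
Proof.
have := nrm_triangle nrmP v (- v).
by rewrite subrr is_norm0 is_normN; lra.
Qed.

Lemma is_norm_sub u v : nrm u <= nrm v + nrm (u - v).
Proof. by have := nrm_triangle nrmP v (u - v); rewrite addrC subrK. Qed.

Lemma coord_le_mx_norm (v : 'rV[R]_m) j : `|v 0 j| <= `|v|.
Proof.
rewrite [leRHS]/Num.norm /= mx_normrE.
by apply: (le_bigmax _ (fun ij : 'I_1 * 'I_m => `|v ij.1 ij.2|) (0, j)).
Qed.

Lemma is_norm_le_mx_norm : exists2 B, 0 <= B & forall v, nrm v <= B * `|v|.
Proof.
exists (\sum_(j < m) nrm (delta_mx 0 j)).
  by apply: sumr_ge0 => j _; exact: is_norm_ge0.
move=> v; rewrite {1}[v]row_sum_delta mulr_suml.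
elim/big_ind2 : _ => [|x1 x2 y1 y2 hx hy|j _].
- by rewrite is_norm0.
- by apply: (le_trans (nrm_triangle nrmP _ _)); exact: lerD.
- rewrite (nrm_scale nrmP) mulrC ler_wpM2l ?is_norm_ge0 //.
  exact: coord_le_mx_norm.
Qed.

Lemma is_norm_continuous : continuous nrm.
Proof.
have [B B0 hB] := is_norm_le_mx_norm.
move=> x; have F : Filter (nbhs x) by exact: nbhs_filter.
apply/(@cvgrPdist_le R R^o _ (nbhs x)) => e e0.
have B1 : 0 < B + 1 by lra.
have d0 : 0 < e / (B + 1) by rewrite divr_gt0.
have hn : \forall y \near nbhs x, `|x - y| <= e / (B + 1).
  exact: (@cvgr_dist_le R 'rV[R]_m _ (nbhs x) _ id x cvg_id _ d0).
apply: filterS hn => y hxy.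
have := is_norm_sub x y; have := is_norm_sub y x.
rewrite -(opprB x y) is_normN => h1 h2.
have h3 : nrm (x - y) <= e.
  apply: (le_trans (hB _)); apply: (@le_trans _ _ ((B + 1) * `|x - y|)).
    by apply: ler_wpM2r => //; lra.
  by rewrite mulrC -ler_pdivlMr.
by rewrite ler_norml; lra.
Qed.

Lemma mx_norm_le_is_norm : exists2 k, 0 <= k & forall v, `|v| <= k * nrm v.
Proof.
pose S := [set v : 'rV[R]_m | `|v| = 1].
have normalize v : v != 0 -> S (`|v|^-1 *: v).
  move=> v0; rewrite /S /= normrZ gtr0_norm ?invr_gt0 ?normr_gt0 //.
  by rewrite mulVf // normr_eq0.
have [S0|S0] := pselect (S !=set0); last first.
  exists 0 => // v; rewrite mul0r; have [->|v0] := eqVneq v 0.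
    by rewrite normr0.
  by case: S0; exists (`|v|^-1 *: v); exact: normalize.
have Sc : compact S.
  apply: bounded_closed_compact.
    exists 1; split; first exact: num_real.
    by move=> M M1 v /= ->; exact: ltW.
  have -> : S = (fun v : 'rV[R]_m => `|v|) @^-1` [set x : R | x = 1] by [].
  apply: preimage_closed; last exact: closed_eq.
  by move=> v _; exact: norm_continuous.
have [c /set_mem cS hc] := compact_EVT_min S0 Sc
  (continuous_subspaceT is_norm_continuous).
have c0 : 0 < nrm c.
  rewrite lt_neqAle is_norm_ge0 andbT eq_sym; apply/eqP => /(nrm_eq0 nrmP) e.
  by move: cS; rewrite /S /= e normr0 => /esym/eqP; rewrite oner_eq0.
exists (nrm c)^-1; first by rewrite invr_ge0 ltW.
move=> v; have [->|v0] := eqVneq v 0; first by rewrite normr0 is_norm0 mulr0.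
have vp : 0 < `|v| by rewrite normr_gt0.
have := hc _ (mem_set (normalize _ v0)).
rewrite (nrm_scale nrmP) gtr0_norm ?invr_gt0 // mulrC ler_pdivlMr //.
by rewrite [(nrm c)^-1 * _]mulrC ler_pdivlMr // mulrC.
Qed.

End NormEquivalence.

Definition concave_rV (R : realType) (m : nat) (g : 'rV[R]_m -> R) :=
  forall u v t, 0 <= t <= 1 ->
    t * g u + (1 - t) * g v <= g (t *: u + (1 - t) *: v).

Section ConcaveRV.
Context (R : realType) (m : nat) (g : 'rV[R]_m -> R).
Hypothesis cg : concave_rV g.

Let G w := g 0 - g w.

Let G_half u v : G (u + v) <= (G (2 *: u) + G (2 *: v)) / 2.
Proof.
have := @cg (2 *: u) (2 *: v) (1 / 2) ltac:(lra).
have h : 1 - 1 / 2 = 1 / 2 :> R by field.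
have h' : 1 / 2 * 2 = 1 :> R by field.
by rewrite h !scalerA h' !scale1r /G; lra.
Qed.

Let G_line d t : `|t| <= 1 -> G (t *: d) <= `|G d| + `|G (- d)|.
Proof.
rewrite ler_norml => ht.
have := @cg d (- d) ((1 + t) / 2) ltac:(lra).
have -> : ((1 + t) / 2) *: d + (1 - (1 + t) / 2) *: (- d) = t *: d.
  by rewrite scalerN -scalerBl; congr (_ *: _); field.
have : (1 + t) / 2 * G d <= (1 + t) / 2 * `|G d|.
  by apply: ler_wpM2l; [lra|exact: ler_norm].
have : (1 - (1 + t) / 2) * G (- d) <= (1 - (1 + t) / 2) * `|G (- d)|.
  by apply: ler_wpM2l; [lra|exact: ler_norm].
have h1 : (1 + t) / 2 * `|G d| <= `|G d| by rewrite ler_piMl //; lra.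
have h2 : (1 - (1 + t) / 2) * `|G (- d)| <= `|G (- d)|.
  by rewrite ler_piMl //; lra.
by move: h1 h2; rewrite /G; lra.
Qed.

Let G_bounded (s : seq 'I_m) c : 0 <= c -> exists2 B, 0 <= B &
  forall v : 'rV[R]_m, `|v| <= c ->
    G (\sum_(j <- s) v 0 j *: delta_mx 0 j) <= B.
Proof.
elim: s c => [|j s IH] c c0.
  by exists 0 => // v _; rewrite big_nil /G subrr.
have [B B0 hB] := IH (2 * c) ltac:(lra).
pose d : 'rV[R]_m := (2 * c) *: delta_mx 0 j.
exists ((`|G d| + `|G (- d)| + B) / 2).
  by rewrite divr_ge0 // !addr_ge0.
move=> v vc; rewrite big_cons; apply: (le_trans (G_half _ _)).
rewrite ler_pM2r ?invr_gt0 //; apply: lerD.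
  have vj := le_trans (coord_le_mx_norm v j) vc.
  have [c00|cn0] := eqVneq c 0.
    have -> : v 0 j = 0.
      by apply/eqP; rewrite -normr_le0; move: vj; rewrite c00.
    rewrite scale0r scaler0 {1}/G subrr addr_ge0 //.
  have cp : 0 < c by rewrite lt_neqAle eq_sym cn0.
  have -> : 2 *: (v 0 j *: delta_mx 0 j) = (v 0 j / c) *: d.
    by rewrite /d !scalerA; congr (_ *: _); field.
  by apply: G_line; rewrite normrM normfV (gtr0_norm cp) ler_pdivrMr // mul1r.
have := hB (2 *: v); rewrite normrZ gtr0_norm // ler_pM2l // => /(_ vc).
rewrite scaler_sumr; congr (G _ <= _); apply: eq_bigr => k _.
by rewrite mxE scalerA.
Qed.

Lemma concave_rV_lipschitz0 : exists2 B, 0 <= B &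
  forall v, g v <= g 0 + B * `|v|.
Proof.
have [B B0 hB] := G_bounded (index_enum 'I_m) ler01.
exists B => // v; have [->|v0] := eqVneq v 0.
  by rewrite normr0 mulr0 addr0.
set t := `|v|; have tp : 0 < t by rewrite normr_gt0.
have t1 : 0 < 1 + t by lra.
have := @cg v (- (t^-1 *: v)) (1 / (1 + t)).
have -> : 0 <= 1 / (1 + t) <= 1.
  by rewrite divr_ge0 ?(ltW t1) //= ler_pdivrMr // mul1r lerDl ltW.
have -> : (1 / (1 + t)) *: v + (1 - 1 / (1 + t)) *: - (t^-1 *: v) = 0.
  rewrite scalerN scalerA -scalerBl.
  have -> : 1 / (1 + t) - (1 - 1 / (1 + t)) * t^-1 = 0.
    by field; rewrite !gt_eqF //; lra.
  by rewrite scale0r.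
move=> /(_ isT).
have := hB (- (t^-1 *: v)).
rewrite -row_sum_delta normrN normrZ gtr0_norm ?invr_gt0 // mulVf ?gt_eqF //.
move=> /(_ (lexx _)); rewrite /G.
move=> h; rewrite -(ler_pM2l t1).
set y := g (- _) in h *.
have -> : (1 + t) * (1 / (1 + t) * g v + (1 - 1 / (1 + t)) * y) = g v + t * y.
  by field; rewrite gt_eqF.
have : t * (g 0 - y) <= t * B by rewrite ler_pM2l.
lra.
Qed.

End ConcaveRV.

Lemma concave_rV_lipschitz (R : realType) (m : nat) (g : 'rV[R]_m -> R) z :
  concave_rV g -> exists2 B, 0 <= B & forall v, g (z + v) <= g z + B * `|v|.
Proof.
move=> cg.
have cg' : concave_rV (fun v => g (z + v)).
  move=> u v t ht /=; apply: (le_trans (cg (z + u) (z + v) t ht)).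
  rewrite !scalerDr addrACA -scalerDl.
  by rewrite [t + (1 - t)]addrC subrK scale1r.
have [B B0 hB] := concave_rV_lipschitz0 cg'.
by exists B => // v; have := hB v; rewrite addr0.
Qed.

(** * The radius utilities of a problem *)

Section RadiusUtility.
Context (R : realType) (n m K N : nat) (pb : problem R n m K N).
Context (nrm : 'rV[R]_m -> R) (p : R) (x : 'rV[R]_n) (i : 'I_N).
Hypotheses (st : setting pb) (reg : regularity pb nrm p).

Definition in_radius (u : R) (v : 'rV[R]_m) : Prop :=
  pZ pb (zhat pb i + v) /\ tcost pb (zhat pb i + v) (zhat pb i) <= u.

Definition radius_utility (k : 'I_K) (u : R) : R :=
  sup [set ell pb k x (zhat pb i + v) | v in in_radius u].

Lemma ell_concave k : concave_rV (ell pb k x).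
Proof.
move=> u v t /andP[t0 t1].
have := reg_ell_concave reg k x (Itv01 t0 t1)
  (mem_set (I : setT u)) (mem_set (I : setT v)).
by rewrite convRE /conv /= /unstable.onem; lra.
Qed.

Lemma in_radius_convex u u' v v' t : 0 <= t <= 1 ->
  in_radius u v -> in_radius u' v' ->
  in_radius (t * u + (1 - t) * u') (t *: v + (1 - t) *: v').
Proof.
move=> /[dup] ht /andP[t0 t1] [Zv cv] [Zv' cv'].
have e : zhat pb i + (t *: v + (1 - t) *: v') =
    t *: (zhat pb i + v) + (1 - t) *: (zhat pb i + v').
  rewrite !scalerDr addrACA -scalerDl.
  by rewrite [t + (1 - t)]addrC subrK scale1r.
rewrite /in_radius e; split.
  have := reg_Z_convex reg (Itv01 t0 t1) (mem_set Zv) (mem_set Zv').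
  by rewrite inE.
have := tcost_convex (setting_cost st) (setting_zhat st i) (Itv01 t0 t1)
  (mem_set Zv) (mem_set Zv').
rewrite convRE /conv /= /unstable.onem => /le_trans; apply.
by apply: lerD; apply: ler_wpM2l; lra.
Qed.

Lemma in_radius0 u : 0 <= u -> in_radius u 0.
Proof.
move=> u0; rewrite /in_radius addr0; split; first exact: setting_zhat.
by rewrite (tcost_diag (setting_cost st)) //; exact: setting_zhat.
Qed.

Lemma in_radius_nrm u v : in_radius u v -> nrm v <= u `^ (1 / p).
Proof.
move=> [Zv cv]; have p1 := reg_p reg.
have := reg_cost reg Zv (setting_zhat st i); rewrite addrC addKr.
move=> h; have n0 := is_norm_ge0 (reg_norm reg) v.
have hp := powR_ge0 (nrm v) p.
have -> : nrm v = (nrm v `^ p) `^ (1 / p).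
  rewrite -powRrM mulrC divfK ?powRr1 //; apply/eqP; lra.
apply: ge0_ler_powR; rewrite ?nnegrE ?divr_ge0 //; lra.
Qed.

Lemma ell_lipschitz : exists2 B, 0 <= B & forall k v,
  ell pb k x (zhat pb i + v) <= ell pb k x (zhat pb i) + B * nrm v.
Proof.
have [kap k0 hk] := mx_norm_le_is_norm (reg_norm reg).
have lipk k : { B : R | 0 <= B & forall v,
    ell pb k x (zhat pb i + v) <= ell pb k x (zhat pb i) + B * `|v| }.
  by apply: cid2; exact: concave_rV_lipschitz (ell_concave k).
pose B k := s2val (lipk k).
have B0 k : 0 <= B k := s2valP (lipk k).
exists ((\sum_k B k) * kap); first by rewrite mulr_ge0 // sumr_ge0.
move=> k v; have hB := s2valP' (lipk k) v; apply: (le_trans hB).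
rewrite lerD2l -mulrA; apply: (@le_trans _ _ (B k * (kap * nrm v))).
  by apply: ler_wpM2l (hk v); exact: B0.
apply: ler_wpM2r; first by rewrite mulr_ge0 // is_norm_ge0 //; exact: reg_norm reg.
by rewrite (bigD1 k) //= lerDl sumr_ge0.
Qed.

Lemma radius_utility_has_sup k u : 0 <= u ->
  has_sup [set ell pb k x (zhat pb i + v) | v in in_radius u].
Proof.
move=> u0; split.
  by exists (ell pb k x (zhat pb i + 0)), 0 => //; exact: in_radius0.
have [B B0 hB] := ell_lipschitz.
exists (ell pb k x (zhat pb i) + B * u `^ (1 / p)) => _ [v hv <-].
apply: (le_trans (hB k v)); rewrite lerD2l ler_wpM2l //.
exact: in_radius_nrm.
Qed.

Lemma radius_utility_ge k u v : 0 <= u -> in_radius u v ->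
  ell pb k x (zhat pb i + v) <= radius_utility k u.
Proof.
move=> u0 hv; apply: sup_upper_bound; first exact: radius_utility_has_sup.
by exists v.
Qed.

Lemma radius_utility_le k u y : 0 <= u ->
  (forall v, in_radius u v -> ell pb k x (zhat pb i + v) <= y) ->
  radius_utility k u <= y.
Proof.
move=> u0 hy; apply: ge_sup; first by have [] := radius_utility_has_sup k u0.
by move=> _ [v hv <-]; exact: hy.
Qed.

Lemma radius_utility_concave k :
  concave_on (@nonneg_real R) (radius_utility k).
Proof.
move=> u u' t; rewrite /nonneg_real => u0 u'0 ht.
have c0 : 0 <= t * u + (1 - t) * u' by rewrite addr_ge0 ?mulr_ge0 //; lra.
apply/ler_addgt0Pr => e e0.
have [_ [v hv <-] H] := sup_adherent e0 (radius_utility_has_sup k u0).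
have [_ [v' hv' <-] H'] := sup_adherent e0 (radius_utility_has_sup k u'0).
have := radius_utility_ge k c0 (in_radius_convex ht hv hv').
have := ell_concave k (zhat pb i + v) (zhat pb i + v') ht.
rewrite !scalerDr addrACA -scalerDl.
have -> : t + (1 - t) = 1 by ring.
rewrite scale1r -/(radius_utility k u) in H *.
rewrite -/(radius_utility k u') in H'.
have : t * (radius_utility k u - e) <= t * ell pb k x (zhat pb i + v).
  by apply: ler_wpM2l; lra.
have : (1 - t) * (radius_utility k u' - e) <=
    (1 - t) * ell pb k x (zhat pb i + v').
  by apply: ler_wpM2l; lra.
lra.
Qed.

Lemma radius_utility_mono k u u' : 0 <= u <= u' ->
  radius_utility k u <= radius_utility k u'.
Proof.
move=> /andP[u0 uu']; apply: radius_utility_le => // v [Zv cv].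
by apply: radius_utility_ge; [lra|split => //; lra].
Qed.

Lemma radius_utility_root : exists2 L, 0 <= L & forall k u, 0 <= u ->
  radius_utility k u <= radius_utility k 0 + L * u `^ (1 / p) /\
  radius_utility k u <= `|ell pb k x (zhat pb i)| + L * u `^ (1 / p).
Proof.
have [B B0 hB] := ell_lipschitz; exists B => // k u u0.
have := radius_utility_ge k (lexx 0) (in_radius0 (lexx 0)); rewrite addr0 => h0.
have h : radius_utility k u <= ell pb k x (zhat pb i) + B * u `^ (1 / p).
  apply: radius_utility_le => // v hv; apply: (le_trans (hB k v)).
  by rewrite lerD2l ler_wpM2l //; exact: in_radius_nrm.
by have := ler_norm (ell pb k x (zhat pb i)); lra.
Qed.

Lemma radius_utility_spec : exists2 L, 0 <= L & exists2 M, 0 <= M &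
  forall k, utility (radius_utility k) L M (1 / p) (1 / p).
Proof.
have [L L0 hL] := radius_utility_root; exists L => //.
exists (\sum_k `|ell pb k x (zhat pb i)| + L); first by rewrite addr_ge0 // sumr_ge0.
move=> k; split.
- exact: radius_utility_concave.
- exact: radius_utility_mono.
- by move=> u u0; have [] := hL k u u0.
move=> u u0; have [_ h] := hL k u u0; apply: (le_trans h).
have : `|ell pb k x (zhat pb i)| <= \sum_k `|ell pb k x (zhat pb i)|.
  by rewrite (bigD1 k) //= lerDl sumr_ge0.
set S := \sum_k _ => hS; have S0 : 0 <= S by apply: le_trans hS.
have := mulr_ge0 S0 (powR_ge0 u (1 / p)); lra.
Qed.

Lemma radius_utility_spec_growth g zh0 r : p = 1 -> growth_bound pb nrm x g zh0 r ->
  exists2 L, 0 <= L & exists2 M, 0 <= M &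
  forall k, utility (radius_utility k) L M (1 / p) r.
Proof.
move=> p1 [g0 Zzh0 r01 hg]; have [L L0 hL] := radius_utility_root.
have nrmP := reg_norm reg.
exists L => //; set c := nrm (zhat pb i - zh0).
have cr := powR_ge0 (2 * c) r.
exists (g * (2 + (2 * c) `^ r)); first by rewrite mulr_ge0 //; lra.
move=> k; split.
- exact: radius_utility_concave.
- exact: radius_utility_mono.
- by move=> u u0; have [] := hL k u u0.
move=> u u0; apply: radius_utility_le => // v hv.
have nv := in_radius_nrm hv; rewrite p1 divr1 powRr1 // in nv.
have [Zv _] := hv; have := hg _ Zv.
have hk : ((ell pb k x (zhat pb i + v))%:E <= loss pb x (zhat pb i + v))%E.
  exact: (le_bigmax -oo%E (fun k : 'I_K => (ell pb k x (zhat pb i + v))%:E) k).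
move=> /(le_trans hk); rewrite lee_fin => /le_trans; apply.
rewrite -mulrA ler_pM2l //.
have tri : nrm (zhat pb i + v - zh0) <= u + c.
  have -> : zhat pb i + v - zh0 = v + (zhat pb i - zh0) by rewrite addrCA addrA.
  by apply: (le_trans (nrm_triangle nrmP _ _)); rewrite lerD2r.
have c0 : 0 <= c := is_norm_ge0 nrmP _.
have ur := powR_ge0 u r.
have sumle : nrm (zhat pb i + v - zh0) `^ r <= 2 * u `^ r + (2 * c) `^ r.
  have n0 := is_norm_ge0 nrmP (zhat pb i + v - zh0).
  have [cu|uc] := leP c u.
    have : nrm (zhat pb i + v - zh0) `^ r <= (2 * u) `^ r.
      by apply: ge0_ler_powR; rewrite ?nnegrE //; lra.
    rewrite [(2 * u) `^ r]powRM //.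
    have : 2 `^ r * u `^ r <= 2 * u `^ r.
      by apply: ler_wpM2r => //; apply: ler1_powR; lra.
    lra.
  have : nrm (zhat pb i + v - zh0) `^ r <= (2 * c) `^ r.
    by apply: ge0_ler_powR; rewrite ?nnegrE //; lra.
  lra.
have := mulr_ge0 cr ur; lra.
Qed.

Lemma wco_radius_utility wco Cost eps k u : wco_assumption pb x wco Cost ->
  0 < eps -> 0 <= u -> exists Lh v t,
  [/\ wco eps k (zhat pb i) u = Some ((Lh, v), t), t <= Cost k eps &
      radius_utility k u - eps <= Lh <= radius_utility k u].
Proof.
move=> hw e0 u0; have [_ /(_ _ _ (setting_zhat st i) u0)] := hw _ k e0.
move=> [Lh [v [t [-> /andP[_ tC] hv -> hs]]]].
exists (ell pb k x (zhat pb i + v)), v, t; split => //.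
rewrite radius_utility_ge // andbT lerBlDr; apply: radius_utility_le => // v' hv'.
rewrite -lee_fin EFinD -leeBlDr //; apply: le_trans hs; apply: leeB => //.
by apply: ereal_sup_ubound; exists v'.
Qed.

Lemma best_penalized_utility_le lam y :
  (forall b, 0 <= b <= N%:R * rho pb -> hull radius_utility b - lam * b <= y) ->
  (exists L M s r q W, exponents L M s r q W /\
    forall k, utility (radius_utility k) L M s r) ->
  (best_penalized_utility pb x i lam <= y%:E)%E.
Proof.
move=> hy [L [M [s [r [q [W [ex U]]]]]]].
apply: ge_ereal_sup => _ [b hb <-]; rewrite /= in hb.
rewrite leeBlDr // -EFinD; apply: bigmax_le; first exact: leNye.
move=> [k1 k2] _ /=; apply: ge_ereal_sup => _ [sp hs <-].
rewrite lee_fin; have := hy b hb.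
suff : alpha1 sp * ell pb k1 x (zhat pb i + disp1 sp) +
  alpha2 sp * ell pb k2 x (zhat pb i + disp2 sp) <= hull radius_utility b by lra.
have b0 : 0 <= b by lra.
have [[a10 a20 b10 b20] [Z1 Z2] [c1 c2] [as1 bs]] := hs.
have pure k a v be : a = 1 -> be <= b -> 0 <= be -> pZ pb (zhat pb i + v) ->
    a * tcost pb (zhat pb i + v) (zhat pb i) <= be ->
    ell pb k x (zhat pb i + v) <= hull radius_utility b.
  move=> -> beb be0 Zv; rewrite mul1r => cv.
  apply: le_trans (hull_ge_pure k U ex k b0); apply: radius_utility_ge => //.
  by split => //; lra.
have [e1|n1] := eqVneq (alpha1 sp) 0.
  have e2 : alpha2 sp = 1 by lra.
  rewrite e1 mul0r add0r {1}e2 mul1r.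
  by apply: (pure _ _ _ _ e2 _ b20 Z2 c2); lra.
have [e2|n2] := eqVneq (alpha2 sp) 0.
  have e1 : alpha1 sp = 1 by lra.
  rewrite e2 mul0r addr0 {1}e1 mul1r.
  by apply: (pure _ _ _ _ e1 _ b10 Z1 c1); lra.
have p1 : 0 < alpha1 sp by rewrite lt_neqAle eq_sym n1.
have p2 : 0 < alpha2 sp by rewrite lt_neqAle eq_sym n2.
have u1 : 0 <= beta1 sp / alpha1 sp by rewrite divr_ge0.
have u2 : 0 <= beta2 sp / alpha2 sp by rewrite divr_ge0.
have := hull_ge_mixture k1 U ex k1 k2 (w := alpha1 sp) _ u1 u2.
have -> : 1 - alpha1 sp = alpha2 sp by lra.
have -> : 0 <= alpha1 sp <= 1 by lra.
rewrite [alpha1 sp * (_ / _)]mulrC [alpha2 sp * (_ / _)]mulrC !divfK // bs.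
move=> /(_ isT); apply: le_trans; apply: lerD; apply: ler_wpM2l => //.
  by apply: radius_utility_ge => //; split => //; rewrite ler_pdivlMr // mulrC.
by apply: radius_utility_ge => //; split => //; rewrite ler_pdivlMr // mulrC.
Qed.

End RadiusUtility.

(** * Accuracy and running time *)

Lemma iteration_count (R : realType) (w eta : R) : 0 <= w -> 0 < eta ->
  exists J : nat, phi R ^+ J * (1 + w) <= eta /\
    J%:R <= 3 * (ln (3 + w) + `|ln (1 / eta)|) + 1.
Proof.
move=> w0 eta0; set y := 3 * _.
have w3 : 0 < 3 + w by lra.
have y0 : 0 <= y by rewrite mulr_ge0 // addr_ge0 // ln_ge0 //; lra.
have /andP[ty yt] := truncn_itv y0.
exists (Num.truncn y).+1; split; last by rewrite -natr1 lerD2r.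
have phi_le : phi R <= expR (- (1 / 3)).
  by have := expR_ge1Dx (- (1 / 3) : R); have := phi_bounds R; lra.
have phi0 : 0 <= phi R by have := phi_bounds R; lra.
have : phi R ^+ (Num.truncn y).+1 <= expR (- (ln (3 + w)) - `|ln (1 / eta)|).
  apply: (@le_trans _ _ (expR (- (1 / 3)) ^+ (Num.truncn y).+1)).
    by rewrite lerXn2r // nnegrE // expR_ge0.
  by rewrite -expRM_natl ler_expR; move: yt; rewrite /y; lra.
rewrite expRD expRN lnK ?posrE // => h.
have le_eta : expR (- `|ln (1 / eta)|) <= eta.
  have -> : eta = expR (- ln (1 / eta)).
    by rewrite expRN lnK ?posrE ?divr_gt0 // div1r invrK.
  rewrite ler_expR expRN lnK ?posrE ?divr_gt0 // div1r invrK.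
  by rewrite lerN2 ler_norm.
have w1 : 0 <= 1 + w by rewrite addr_ge0.
apply: (le_trans (ler_wpM2r w1 h)); rewrite mulrAC.
apply: le_trans le_eta; rewrite ler_piMl ?expR_ge0 //.
by rewrite mulrC ler_pdivrMr // mul1r lerD2r ler1n.
Qed.

Lemma nested_time_le (R : realType) (k c X : R) : 1 <= k -> 1 <= c -> 1 <= X ->
  X * (k * (X * (2 * (X * (2 * (2 * c + 1) + 2)) + 2) + 1) + 1) <=
  20 * (k * c * X ^+ 3).
Proof.
move=> k1 c1 X1.
have X2 : 1 <= X * X by rewrite mulr_ege1.
have cX : X <= X * X * c.
  by rewrite -mulrA ler_peMr ?mulr_ege1 //; lra.
have cX2 : 1 <= X * X * c by rewrite mulr_ege1.
have inner : X * (2 * (X * (2 * (2 * c + 1) + 2)) + 2) + 1 <= 19 * (X * X * c).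
  have : X * X <= X * X * c by rewrite ler_peMr //; lra.
  lra.
have k19 : k * (X * (2 * (X * (2 * (2 * c + 1) + 2)) + 2) + 1) <=
    k * (19 * (X * X * c)) by apply: ler_wpM2l => //; lra.
have kXc : 1 <= k * (X * X * c) by rewrite mulr_ege1.
have -> : 20 * (k * c * X ^+ 3) = X * (20 * (k * (X * X * c))).
  by rewrite !exprS expr0; ring.
by apply: ler_wpM2l; lra.
Qed.

Section Guarantee.
Context (R : realType) (n m K N : nat) (pb : problem R n m K N).
Context (nrm : 'rV[R]_m -> R) (p : R) (x : 'rV[R]_n) (i : 'I_N) (lam : R).
Hypotheses (st : setting pb) (reg : regularity pb nrm p).
Hypothesis (lam0 : 0 <= lam).
Context (L M s r q : R).
Hypothesis U : forall k, utility (radius_utility pb x i k) L M s r.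
Hypothesis ex : exponents L M s r q (1 + N%:R * rho pb).

Lemma budget_guarantee : exists C : R,
  forall (wco : oracle R m K) (Cost : 'I_K -> R -> R) (eps eta Coste : R),
  wco_assumption pb x wco Cost -> 0 < eps -> 0 < eta ->
  (forall k, Cost k eps <= Coste) ->
  exists (J : nat) bhat (o : local_output R m K) t,
  [/\ budget_eval pb wco eps eta i lam = Some ((bhat, o), t),
    (best_penalized_utility pb x i lam - (o.1.1 - lam * bhat)%:E
      <= (C * (eps + eta `^ q))%:E)%E,
    J%:R <= 3 * (ln (3 + N%:R * rho pb) + `|ln (1 / eta)|) + 1,
    1 <= Coste &
    t <= J.+3%:R * (K%:R ^+ 2 * (J.+2%:R * (2 * (J.+2%:R *
      (2 * (2 * Coste + 1) + 2)) + 2) + 1) + 1)].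
Proof.
have [L0 M0 s01 r01 q0 qs qr W1] := ex.
pose h := radius_utility pb x i; pose W := 1 + N%:R * rho pb.
have {}W1 : 1 <= W := W1.
have W00 : 0 <= N%:R * rho pb by rewrite mulr_ge0 // ltW // setting_rho.
have K2 := reg_K reg.
pose H0 := \sum_k `|h k 0|.
have hH0 k : `|h k 0| <= H0.
  by rewrite /H0 (bigD1 k) //= lerDl sumr_ge0.
have H00 : 0 <= H0 by rewrite sumr_ge0.
set C1 := L * W; set C2 := 2 * (H0 + M * (2 + W)).
set C3 := 2 * L * W + lam * W.
have C10 : 0 <= C1 by rewrite mulr_ge0 //; lra.
have C20 : 0 <= C2.
  by rewrite mulr_ge0 // addr_ge0 // mulr_ge0 //; lra.
have C30 : 0 <= C3.
  by rewrite /C3 -mulrA addr_ge0 // mulr_ge0 //; lra.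
exists (36 + 12 * C1 + 4 * C2 + C3).
move=> wco Cost eps eta Coste hw eps0 eta0 hC.
have [J [hJ Jle]] := iteration_count W00 eta0.
have Coste1 : 1 <= Coste.
  have [h1 _] := hw _ (Ordinal K2) eps0; exact: le_trans h1 (hC _).
have wcoP k u : 0 <= u -> exists Lh v t,
  [/\ wco eps k (zhat pb i) u = Some ((Lh, v), t), t <= Coste &
      h k u - eps <= Lh <= h k u].
  move=> u0; have [Lh [v [t [e tC hL]]]] :=
    wco_radius_utility i st reg k hw eps0 u0.
  by exists Lh, v, t; split => //; apply: le_trans tC (hC k).
have Coste0 : 0 <= Coste by lra.
have W0W : 0 <= N%:R * rho pb <= W by rewrite /W; lra.
have [bhat [out [t [E Ht Hv]]]] := budget_eval_spec U ex hH0 eps0 eta0 Coste0 hJ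
  wcoP K2 lam0 W0W.
exists J, bhat, out, t; split => //.
rewrite leeBlDr // -EFinD.
apply: (best_penalized_utility_le st reg); last first.
  by exists L, M, s, r, q, W; split; [exact: ex|exact: U].
move=> b hb; apply: (le_trans (Hv b hb)).
rewrite -/C1 -/C2 -/C3 addrC lerD2r.
have e0 := powR_ge0 eta q.
have : 0 <= C1 * eps by rewrite mulr_ge0 // ltW.
have : 0 <= C2 * eps by rewrite mulr_ge0 // ltW.
have : 0 <= C3 * eps by rewrite mulr_ge0 // ltW.
lra.
Qed.

Lemma budget_error_bound : exists C : R,
  forall (wco : oracle R m K) (Cost : 'I_K -> R -> R),
  wco_assumption pb x wco Cost -> forall eps eta : R, 0 < eps -> 0 < eta ->
  budget_error_le pb x wco i lam C q eps eta.
Proof.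
have [C hC] := budget_guarantee; exists C => wco Cost hw eps eta eps0 eta0.
have le_sum k : Cost k eps <= \sum_k Cost k eps.
  rewrite (bigD1 k) //= lerDl sumr_ge0 // => k' _.
  by have [h1 _] := hw _ k' eps0; apply: le_trans h1.
have [J [bhat [out [t [E He _ _ _]]]]] := hC _ _ _ _ _ hw eps0 eta0 le_sum.
by exists bhat, out, t.
Qed.

Lemma budget_time_bound (wco : oracle R m K) (Cost : 'I_K -> R -> R) :
  wco_assumption pb x wco Cost ->
  forall eps eta Coste : R, 0 < eps -> 0 < eta <= 1 / 2 ->
  (forall k, Cost k eps <= Coste) ->
  budget_time_le pb wco i lam eps eta
    (20 * 32 ^+ 3 * (K%:R ^+ 2 * Coste * ln (1 / eta) ^+ 3)
       * ln (3 + N%:R * rho pb) ^+ 3).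
Proof.
move=> hw eps eta Coste eps0 /andP[eta0 eta2] hC.
have [C /(_ _ _ _ _ _ hw eps0 eta0 hC)] := budget_guarantee.
move=> [J [bhat [out [t [E _ Jle Coste1 Ht]]]]].
exists (bhat, out), t; split => //; apply: (le_trans Ht).
have W00 : 0 <= N%:R * rho pb by rewrite mulr_ge0 // ltW // setting_rho.
have half (y : R) : 2 <= y -> 1 / 2 <= ln y.
  move=> y2; have y0 : 0 < y by lra.
  rewrite -ler_expR lnK ?posrE //; apply: le_trans y2.
  have := expR_ge1Dx (- (1 / 2) : R); rewrite expRN.
  have e0 := expR_gt0 (1 / 2 : R).
  by rewrite -(ler_pM2r e0) mulVf ?gt_eqF //; lra.
have l2 : 1 / 2 <= ln (1 / eta).
  by apply: half; rewrite ler_pdivlMr //; lra.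
have M2 : 1 / 2 <= ln (3 + N%:R * rho pb) by apply: half; lra.
set l := ln (1 / eta) in l2 Jle *.
set M' := ln (3 + N%:R * rho pb) in M2 Jle *.
have XJ : J.+3%:R <= 32 * (l * M').
  rewrite -[J.+3%:R]natr1 -[J.+2%:R]natr1 -[J.+1%:R]natr1.
  move: Jle; rewrite ger0_norm; last lra.
  have : (l - 1 / 2) * M' >= 0 by rewrite mulr_ge0 //; lra.
  have : l * (M' - 1 / 2) >= 0 by rewrite mulr_ge0 //; lra.
  lra.
have X1 : 1 <= J.+3%:R :> R by rewrite ler1n.
have K1 : 1 <= K%:R ^+ 2 :> R.
  by rewrite exprn_ege1 // ler1n; apply: leq_trans (reg_K reg).
apply: (@le_trans _ _ (20 * (K%:R ^+ 2 * Coste * J.+3%:R ^+ 3))).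
  apply: le_trans (nested_time_le K1 Coste1 X1).
  have J23 : J.+2%:R <= J.+3%:R :> R by rewrite ler_nat.
  have J20 : 0 <= J.+2%:R :> R by [].
  have c0 : 0 <= 2 * (2 * Coste + 1) + 2 by lra.
  apply: ler_wpM2l => //; rewrite lerD2r; apply: ler_wpM2l; first lra.
  rewrite lerD2r; apply: ler_pM => //.
    by rewrite addr_ge0 // mulr_ge0 // mulr_ge0.
  by rewrite lerD2r; apply: ler_wpM2l => //; apply: ler_wpM2r.
have -> : 20 * 32 ^+ 3 * (K%:R ^+ 2 * Coste * l ^+ 3) * M' ^+ 3 =
    20 * (K%:R ^+ 2 * Coste * (32 * (l * M')) ^+ 3) by rewrite !exprMn; ring.
apply: ler_wpM2l => //; apply: ler_wpM2l; first by rewrite mulr_ge0 //; lra.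
by rewrite lerXn2r ?nnegrE //; apply: le_trans XJ.
Qed.

End Guarantee.

Theorem lemma4 (R : realType) :
  exists (A : R) (d : nat),
  forall (n m K N : nat) (pb : problem R n m K N)
    (nrm : 'rV[R]_m -> R) (p : R)
    (x : 'rV[R]_n) (i : 'I_N) (lam : R),
    setting pb ->
    regularity pb nrm p ->
    pX pb x ->
    0 <= lam ->
    [/\ 1 < p ->
          exists C : R, forall (wco : oracle R m K) (Cost : 'I_K -> R -> R),
            wco_assumption pb x wco Cost ->
            forall eps eta : R, 0 < eps -> 0 < eta ->
              budget_error_le pb x wco i lam C
                (Num.min (1 / p) (1 - 1 / p)) eps eta,
        p = 1 ->
          forall (g : R) (zh0 : 'rV[R]_m) (r : R),
            growth_bound pb nrm x g zh0 r ->
            exists C : R, forall (wco : oracle R m K) (Cost : 'I_K -> R -> R),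
              wco_assumption pb x wco Cost ->
              forall eps eta : R, 0 < eps -> 0 < eta ->
                budget_error_le pb x wco i lam C (1 - r) eps eta
      & forall (wco : oracle R m K) (Cost : 'I_K -> R -> R),
          wco_assumption pb x wco Cost ->
          forall eps eta Coste : R, 0 < eps -> 0 < eta <= 1 / 2 ->
            (forall k, Cost k eps <= Coste) ->
            budget_time_le pb wco i lam eps eta
              (A * (K%:R ^+ 2 * Coste * ln (1 / eta) ^+ 3)
                 * ln (3 + N%:R * rho pb) ^+ d)].
Proof.
exists (20 * 32 ^+ 3), 3%N => n m K N pb nrm p x i lam st reg Xx lam0.
have W1 : 1 <= 1 + N%:R * rho pb.
  by rewrite lerDl mulr_ge0 // ltW // setting_rho.
have gt1 : 1 < p -> exists L M, exponents L M (1 / p) (1 / p)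
    (Num.min (1 / p) (1 - 1 / p)) (1 + N%:R * rho pb) /\
    forall k, utility (radius_utility pb x i k) L M (1 / p) (1 / p).
  move=> p1; have [L L0 [M M0 U]] := radius_utility_spec x i st reg.
  have ip0 : 0 < 1 / p by rewrite divr_gt0 //; lra.
  have ip1 : 1 / p < 1 by rewrite ltr_pdivrMr ?mul1r //; lra.
  exists L, M; split => //; split => //; try lra.
  - by rewrite le_min; lra.
  - by rewrite ge_min lexx.
  - by rewrite ge_min lexx orbT.
have eq1 g zh0 r : p = 1 -> growth_bound pb nrm x g zh0 r ->
    exists L M, exponents L M (1 / p) r (1 - r) (1 + N%:R * rho pb) /\
    forall k, utility (radius_utility pb x i k) L M (1 / p) r.
  move=> p1 hg; have [L L0 [M M0 U]] := radius_utility_spec_growth i st reg p1 hg.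
  have [_ _ r01 _] := hg.
  exists L, M; split => //; rewrite p1 divr1; split => //; lra.
split.
- by move=> /gt1[L [M [ex U]]]; exact: (budget_error_bound st reg lam0 U ex).
- move=> p1 g zh0 r /(eq1 _ _ _ p1)[L [M [ex U]]].
  exact: (budget_error_bound st reg lam0 U ex).
move=> wco Cost; have := reg_p reg; rewrite le_eqVlt => /orP[/eqP p1|p1].
  have [g [zh0 [r hg]]] := reg_growth reg (esym p1) Xx.
  have [L [M [ex U]]] := eq1 _ _ _ (esym p1) hg.
  exact: (budget_time_bound st reg lam0 U ex).
have [L [M [ex U]]] := gt1 p1.
exact: (budget_time_bound st reg lam0 U ex).
Qed.
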